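(* Let $R$ be an even Hecke symmetry of rank $r$ on $V$ and let $n\ge1$. The map $\mathcal{H}_n\to H_R$, $h\mapsto\Phi(\rho_n(h))$, is a trace map on $\mathcal{H}_n$ (it is $\mathbb{K}$-linear and $\Phi(\rho_n(hh'))=\Phi(\rho_n(h'h))$ for all $h,h'\in\mathcal{H}_n$) with values in $\Lambda_R$, the subalgebra of $E_R$ spanned by $\{S_\lambda=\Phi(M_\lambda)\mid\lambda\in\mathcal{P}^r\}$.
   Context: Everything is over an algebraically closed field $\mathbb{K}$ of characteristic $0$; $q\in\mathbb{K}^\times$ satisfies $q^n\ne1$ for all $n>1$, and a square root $q^{1/2}$ is fixed. Repeated upper/lower indices are summed; upper indices are row indices. Let $V$ have basis $x_1,\dots,x_d$. A Hecke symmetry is an operator $R:V\otimes V\to V\otimes V$, $R(x_i\otimes x_j)=x_k\otimes x_l R^{kl}_{ij}$, with $R_1R_2R_1=R_2R_1R_2$ on $V^{\otimes 3}$, $(R-q)(R+1)=0$, and closed: there is a matrix $P^{ij}_{kl}$ with $P^{ip}_{jq}R^{qk}_{pl}=\delta^i_l\delta^k_j$. On $V^{\otimes n}$ put $R_i=\mathrm{id}_V^{\otimes (i-1)}\otimes R\otimes \mathrm{id}_V^{\otimes (n-i-1)}$. The Hecke algebra $\mathcal{H}_n$ (generators $T_1,\dots,T_{n-1}$, braid relations, $T_i^2=(q-1)T_i+q$, basis $T_w$, $w\in\mathfrak{S}_n$) acts on $V^{\otimes n}$ by $\rho_n(T_i)=R_i$; put $R_w=\rho_n(T_w)$. $R$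 is even of rank $r$ if $\sum_{w\in\mathfrak S_n}(-q)^{-l(w)}R_w$ is nonzero for $n=r$ and zero for $n=r+1$. $\mathcal{H}_n$ is semisimple; its irreducible characters $\chi^\lambda$ are labelled by partitions $\lambda\vdash n$ in the standard way: restriction from $\mathcal{H}_n$ to $\mathcal{H}_{n-1}=\langle T_1,\dots,T_{n-2}\rangle$ is given by removing one node from the diagram, and for $n=2$, $T_1$ acts by $q$ for $(2)$ and by $-1$ for $(1,1)$. $E_\lambda$ is a primitive idempotent with $\chi^\mu(E_\lambda)=\delta_{\lambda\mu}$. $\mathcal{P}^r$ is the set of all partitions with at most $r$ nonzero parts. $H_R$ is the algebra generated by $z^i_j,t^i_j$ ($1\le i,j\le d$) with relations $R^{ij}_{mn}z^m_kz^n_l=z^i_pz^j_qR^{pq}_{kl}$, $t^i_kz^k_j=z^i_kt^k_j=\delta^i_j$; $\Delta(z^i_j)=z^i_k\otimes z^k_j$. $E_R$ is the bialgebra generated by the $z^i_j$ with the first relation; it embeds in $H_R$. $V$ is a right comodule via $x_i\mapsto x_j\otimes z^j_i$, and the endomorphisms of the comodule $V^{\otimes n}$ are exactly $\rho_n(\mathcal{H}_n)$. Put $D^i_j=P^{li}_{lj}$, $(D^{\otimes n})^I_J=D^{i_1}_{j_1}\cdots D^{i_n}_{j_n}$, $(Z^{\otimes n})^I_J=z^{i_1}_{j_1}\cdots z^{i_n}_{j_n}$. The character of a comodule endomorphism $f$ of $V^{\otimes n}$ with matrix $F$ is $\Phi(f)=q^{n(r+1)/2}\mathrm{tr}(D^{\otimes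 n}FZ^{\otimes n})$ ($\mathrm{tr}$ the usual trace over multi-indices). For $\lambda\vdash n$, $M_\lambda=\mathrm{Im}(\rho_n(E_\lambda))\subset V^{\otimes n}$ and $S_\lambda=\Phi(M_\lambda)=\Phi(\rho_n(E_\lambda))$ (for the empty partition, $S_\emptyset=1$). *)

(* Defs.v *)
From HB Require Import structures.
From mathcomp Require Import all_boot all_order all_fingroup all_algebra.
From mathcomp Require Import generic_quotient finmap boolp.
From mathcomp.multinomials Require Import monalg.

Set Implicit Arguments.
Unset Strict Implicit.
Unset Printing Implicit Defensive.

Import GRing.Theory.
Local Open Scope ring_scope.

(* The free associative algebra K<X>: finitely supported combinations of words
   in the alphabet X. *)
Definition free_alg (K : fieldType) (X : choiceType) := {malg K[{fmonom X}]}.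

HB.instance Definition _ (K : fieldType) (X : choiceType) :=
  GRing.Zmodule.on (free_alg K X).

(* The operations are those of the monoid algebra; locking them (here and
   below) only prevents unification from unfolding them. *)
HB.lock Definition fa_mul (K : fieldType) (X : choiceType)
    (x y : {malg K[{fmonom X}]}) : free_alg K X := x * y.
HB.lock Definition fa_scale (K : fieldType) (X : choiceType)
    (k : K) (x : {malg K[{fmonom X}]}) : free_alg K X := k *: x.

Section FreeAlgebra.
Variables (K : fieldType) (X : choiceType).
Local Notation MA := {malg K[{fmonom X}]}.
Local Notation fa_mul := (@fa_mul K X).
Local Notation fa_scale := (@fa_scale K X).

Fact fa_mulA : @associative (free_alg K X) fa_mul.
Proof. by move=> x y z; rewrite fa_mul.unlock; apply: (@mulrA MA). Qed.
Fact fa_mul1l : @left_id _ (free_alg K X) (1 : MA) fa_mul.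
Proof. by move=> x; rewrite fa_mul.unlock; apply: (@mul1r MA). Qed.
Fact fa_mul1r : @right_id (free_alg K X) _ (1 : MA) fa_mul.
Proof. by move=> x; rewrite fa_mul.unlock; apply: (@mulr1 MA). Qed.
Fact fa_mulDl : @left_distributive (free_alg K X) (free_alg K X) fa_mul +%R.
Proof. by move=> x y z; rewrite fa_mul.unlock; apply: (@mulrDl MA). Qed.
Fact fa_mulDr : @right_distributive (free_alg K X) (free_alg K X) fa_mul +%R.
Proof. by move=> x y z; rewrite fa_mul.unlock; apply: (@mulrDr MA). Qed.
Fact fa_oner_neq0 : (1 : MA) != 0 :> free_alg K X.
Proof. exact: (@oner_neq0 MA). Qed.
HB.instance Definition _ := GRing.Zmodule_isNzRing.Build (free_alg K X)
  fa_mulA fa_mul1l fa_mul1r fa_mulDl fa_mulDr fa_oner_neq0.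

Fact fa_scaleA a b (x : free_alg K X) :
  fa_scale a (fa_scale b x) = fa_scale (a * b) x.
Proof. by rewrite fa_scale.unlock; apply: (@scalerA _ MA). Qed.
Fact fa_scale1 : @left_id _ (free_alg K X) 1 fa_scale.
Proof. by move=> x; rewrite fa_scale.unlock; apply: (@scale1r _ MA). Qed.
Fact fa_scaleDr : @right_distributive _ (free_alg K X) fa_scale +%R.
Proof. by move=> a x y; rewrite fa_scale.unlock; apply: (@scalerDr _ MA). Qed.
Fact fa_scaleDl (x : free_alg K X) : {morph fa_scale^~ x : a b / a + b}.
Proof. by move=> a b; rewrite fa_scale.unlock; apply: (@scalerDl _ MA). Qed.
HB.instance Definition _ := GRing.Zmodule_isLmodule.Build K (free_alg K X)
  fa_scaleA fa_scale1 fa_scaleDr fa_scaleDl.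

Lemma free_algME (x y : free_alg K X) : x * y = (x : MA) * (y : MA).
Proof. by rewrite [LHS]/GRing.mul /= fa_mul.unlock. Qed.
Lemma free_algZE k (x : free_alg K X) : k *: x = k *: (x : MA).
Proof. by rewrite [LHS]/GRing.scale /= fa_scale.unlock. Qed.

Fact fa_scalerAl (k : K) (x y : free_alg K X) : k *: (x * y) = (k *: x) * y.
Proof. by rewrite !free_algME !free_algZE -(scalerAl k (x : MA)). Qed.
Fact fa_scalerAr (k : K) (x y : free_alg K X) : k *: (x * y) = x * (k *: y).
Proof.
rewrite !free_algME !free_algZE.
rewrite (_ : k *: (y : MA) = malgC k * (y : MA)); last by rewrite mul_malgC.
rewrite mulrA (_ : (x : MA) * malgC k = k *: (x : MA)) ?scalerAl //.
rewrite malgM_def fgmulgU malgZ_def.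
by apply: eq_bigr => m _; rewrite mulm1 mulrC.
Qed.
HB.instance Definition _ :=
  GRing.Lmodule_isLalgebra.Build K (free_alg K X) fa_scalerAl.
HB.instance Definition _ :=
  GRing.Lalgebra_isAlgebra.Build K (free_alg K X) fa_scalerAr.
End FreeAlgebra.

HB.lock Definition gen (K : fieldType) (X : choiceType) (x : X) :
  free_alg K X := mkmalgU (fmu x) 1.

Section WordExtension.
Variables (K : fieldType) (X : choiceType).

(* The linear extension of a map defined on words. *)
Section WordExt.
Variables (U : lmodType K) (f : seq X -> U).
Definition word_ext (g : free_alg K X) : U :=
  \sum_(m <- msupp g) mcoeff m g *: f m.

Let word_extEw (d : {fset {fmonom X}}) (g : free_alg K X) :
  fsubset (msupp g) d -> word_ext g = \sum_(m <- d) mcoeff m g *: f m.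
Proof.
move=> le; rewrite [LHS](big_fset_incl _ le) //= => x _ /mcoeff_outdom ->.
by rewrite scale0r.
Qed.

Lemma word_ext_is_linear : linear word_ext.
Proof.
move=> a g1 g2; set d := fsetU (msupp g1) (msupp g2).
rewrite !(@word_extEw d) ?fsubsetUl ?fsubsetUr //.
  rewrite scaler_sumr -big_split; apply: eq_bigr => m _ /=.
  by rewrite free_algZE mcoeffD mcoeffZ scalerDl scalerA.
rewrite free_algZE; apply: fsubset_trans (msuppD_le _ _) _.
by rewrite fsetSU // msuppZ_le.
Qed.
HB.instance Definition _ :=
  GRing.isLinear.Build K (free_alg K X) U *:%R word_ext word_ext_is_linear.

Lemma word_ext_word (w : seq X) : word_ext (\prod_(x <- w) gen K x) = f w.
Proof.
have -> : \prod_(x <- w) gen K x = mkmalgU (fmonom_of_seq fmonom_key w) 1.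
  elim: w => [|x w IH]; first by rewrite big_nil.
  rewrite big_cons IH gen.unlock free_algME malgM_def fgmulUU mulr1.
  by congr (mkmalgU _ _); apply/eqP; rewrite fmP fmM fmU !fmE.
rewrite /word_ext msuppU oner_eq0 big_seq_fset1 mcoeffUU scale1r.
by rewrite fmE.
Qed.
End WordExt.

End WordExtension.

Section WordEval.
Variables (K : fieldType) (X : choiceType) (f : X -> K).
Definition word_eval (m : {fmonom X}) : K := \prod_(x <- (m : seq X)) f x.
Lemma word_eval_mmorphism : mmorphism word_eval.
Proof.
split=> [m1 m2|]; first by rewrite /word_eval fmM big_cat.
by rewrite /word_eval fm1 big_nil.
Qed.
HB.instance Definition _ :=
  isMultiplicative.Build {fmonom X} K word_eval word_eval_mmorphism.

End WordEval.

HB.lock Definition free_eval (K : fieldType) (X : choiceType) (f : X -> K)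
  (g : free_alg K X) : K := mmap idfun (word_eval f) g.

Section FreeEval.
Variables (K : fieldType) (X : choiceType) (f : X -> K).
Local Notation free_eval := (free_eval f).

Lemma free_evalE g : free_eval g = mmap idfun (word_eval f) g.
Proof. by rewrite free_eval.unlock. Qed.
Lemma free_evalB g1 g2 : free_eval (g1 - g2) = free_eval g1 - free_eval g2.
Proof. by rewrite !free_evalE mmapB. Qed.
Lemma free_evalD g1 g2 : free_eval (g1 + g2) = free_eval g1 + free_eval g2.
Proof. by rewrite !free_evalE mmapD. Qed.
Lemma free_eval0 : free_eval 0 = 0.
Proof. by rewrite free_evalE mmap0. Qed.
Lemma free_eval1 : free_eval 1 = 1.
Proof. by rewrite free_evalE mmap1. Qed.
Lemma free_evalM g1 g2 : free_eval (g1 * g2) = free_eval g1 * free_eval g2.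
Proof.
rewrite !free_evalE free_algME.
exact: (mmap_is_multiplicative (f := idfun) (h := word_eval f)).1.
Qed.
Lemma free_evalZ c g : free_eval (c *: g) = c * free_eval g.
Proof. by rewrite !free_evalE free_algZE mmapZ. Qed.
Lemma free_eval_sum I (s : seq I) F :
  free_eval (\sum_(i <- s) F i) = \sum_(i <- s) free_eval (F i).
Proof. exact: (big_morph _ free_evalD free_eval0). Qed.
Lemma free_eval_nat (b : bool) : free_eval b%:R = b%:R.
Proof. by case: b; [exact: free_eval1 | exact: free_eval0]. Qed.
Lemma free_eval_gen x : free_eval (gen K x) = f x.
Proof. by rewrite free_evalE gen.unlock mmapU mul1r /word_eval fmU big_seq1. Qed.
End FreeEval.

(* The two-sided ideal generated by S. *)
Inductive ideal_gen (A : nzRingType) (S : A -> Prop) : A -> Prop :=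
| ideal_gen0 : ideal_gen S 0
| ideal_genD a s b y : S s -> ideal_gen S y -> ideal_gen S (a * s * b + y).

Section QuotientAlgebra.
Variables (K : fieldType) (A : algType K) (S : A -> Prop).
Local Notation I := (ideal_gen S).

Lemma ideal_add x y : I x -> I y -> I (x + y).
Proof.
move=> Ix Iy; elim: Ix => [|a s b z Ss _ IH]; first by rewrite add0r.
by rewrite -addrA; apply: ideal_genD.
Qed.
Lemma ideal_mull a x : I x -> I (a * x).
Proof.
elim=> [|c s b z Ss _ IH]; first by rewrite mulr0; apply: ideal_gen0.
by rewrite mulrDr !mulrA; apply: ideal_genD.
Qed.
Lemma ideal_mulr a x : I x -> I (x * a).
Proof.
elim=> [|c s b z Ss _ IH]; first by rewrite mul0r; apply: ideal_gen0.
by rewrite mulrDl -mulrA; apply: ideal_genD.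
Qed.
Lemma ideal_opp x : I x -> I (- x).
Proof. by rewrite -mulN1r; apply: ideal_mull. Qed.
Lemma ideal_scale (k : K) x : I x -> I (k *: x).
Proof. by move=> Ix; rewrite -[x]mul1r scalerAl; apply: ideal_mull. Qed.

Definition ideal_cong (x y : A) : bool := `[< I (x - y) >].
Lemma ideal_cong_refl : reflexive ideal_cong.
Proof. by move=> x; apply/asboolP; rewrite subrr; apply: ideal_gen0. Qed.
Lemma ideal_cong_sym : symmetric ideal_cong.
Proof.
by move=> x y; apply/asboolP/asboolP => /ideal_opp; rewrite opprB.
Qed.
Lemma ideal_cong_trans : transitive ideal_cong.
Proof.
move=> y x z /asboolP Ixy /asboolP Iyz; apply/asboolP.
by have := ideal_add Ixy Iyz; rewrite addrA subrK.
Qed.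
Canonical ideal_equiv :=
  EquivRel ideal_cong ideal_cong_refl ideal_cong_sym ideal_cong_trans.

Definition alg_quot := {eq_quot ideal_equiv}%qT.
HB.instance Definition _ := Choice.on alg_quot.
HB.instance Definition _ := EqQuotient.on alg_quot.

Definition aq (x : A) : alg_quot := (\pi_(alg_quot) x)%qT.

Lemma aq_eqP x y : aq x = aq y <-> I (x - y).
Proof.
by split=> [/eqP|H]; [|apply/eqP]; rewrite /aq eqmodE => *; apply/asboolP.
Qed.
Lemma aq_repr (u : alg_quot) : aq (repr u) = u.
Proof. exact: reprK. Qed.
Lemma repr_aq x : I (repr (aq x) - x).
Proof. by apply/aq_eqP; rewrite aq_repr. Qed.

End QuotientAlgebra.

HB.lock Definition aq_add (K : fieldType) (A : algType K) (S : A -> Prop)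
  (u v : alg_quot S) : alg_quot S := aq S (repr u + repr v).
HB.lock Definition aq_opp (K : fieldType) (A : algType K) (S : A -> Prop)
  (u : alg_quot S) : alg_quot S := aq S (- repr u).
HB.lock Definition aq_mul (K : fieldType) (A : algType K) (S : A -> Prop)
  (u v : alg_quot S) : alg_quot S := aq S (repr u * repr v).
HB.lock Definition aq_scale (K : fieldType) (A : algType K) (S : A -> Prop)
  (k : K) (u : alg_quot S) : alg_quot S := aq S (k *: repr u).

Section QuotientAlgebraTheory.
Variables (K : fieldType) (A : algType K) (S : A -> Prop).
Local Notation alg_quot := (alg_quot S).
Local Notation aq := (aq S).
Local Notation aq_add := (@aq_add K A S).
Local Notation aq_opp := (@aq_opp K A S).
Local Notation aq_mul := (@aq_mul K A S).
Local Notation aq_scale := (@aq_scale K A S).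

Lemma aq_addE x y : aq_add (aq x) (aq y) = aq (x + y).
Proof.
rewrite aq_add.unlock; apply/aq_eqP; rewrite opprD addrACA.
by apply: ideal_add; apply: repr_aq.
Qed.
Lemma aq_oppE x : aq_opp (aq x) = aq (- x).
Proof.
by rewrite aq_opp.unlock; apply/aq_eqP; rewrite -opprD; apply/ideal_opp/repr_aq.
Qed.
Lemma aq_mulE x y : aq_mul (aq x) (aq y) = aq (x * y).
Proof.
rewrite aq_mul.unlock; apply/aq_eqP; set x' := repr _; set y' := repr _.
rewrite (_ : _ - _ = (x' - x) * y' + x * (y' - y)).
  by apply: ideal_add; [apply: ideal_mulr | apply: ideal_mull]; apply: repr_aq.
by rewrite mulrBl mulrBr addrA subrK.
Qed.
Lemma aq_scaleE k x : aq_scale k (aq x) = aq (k *: x).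
Proof.
rewrite aq_scale.unlock; apply/aq_eqP; rewrite -scalerBr.
exact/ideal_scale/repr_aq.
Qed.

Fact aq_ind (P : alg_quot -> Prop) : (forall x, P (aq x)) -> forall u, P u.
Proof. by move=> H u; rewrite -(aq_repr u). Qed.

Fact aq_addA : associative aq_add.
Proof.
by elim/aq_ind=> x; elim/aq_ind=> y; elim/aq_ind=> z; rewrite !aq_addE addrA.
Qed.
Fact aq_addC : commutative aq_add.
Proof. by elim/aq_ind=> x; elim/aq_ind=> y; rewrite !aq_addE addrC. Qed.
Fact aq_add0 : left_id (aq 0) aq_add.
Proof. by elim/aq_ind=> x; rewrite aq_addE add0r. Qed.
Fact aq_addN : left_inverse (aq 0) aq_opp aq_add.
Proof. by elim/aq_ind=> x; rewrite aq_oppE aq_addE addNr. Qed.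
HB.instance Definition _ :=
  GRing.isZmodule.Build alg_quot aq_addA aq_addC aq_add0 aq_addN.

Lemma aqD x y : aq (x + y) = aq x + aq y. Proof. by rewrite -aq_addE. Qed.

Fact aq_mulA : associative aq_mul.
Proof.
by elim/aq_ind=> x; elim/aq_ind=> y; elim/aq_ind=> z; rewrite !aq_mulE mulrA.
Qed.
Fact aq_mul1l : left_id (aq 1) aq_mul.
Proof. by elim/aq_ind=> x; rewrite aq_mulE mul1r. Qed.
Fact aq_mul1r : right_id (aq 1) aq_mul.
Proof. by elim/aq_ind=> x; rewrite aq_mulE mulr1. Qed.
Fact aq_mulDl : left_distributive aq_mul +%R.
Proof.
elim/aq_ind=> x; elim/aq_ind=> y; elim/aq_ind=> z.
by rewrite -aqD !aq_mulE mulrDl aqD.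
Qed.
Fact aq_mulDr : right_distributive aq_mul +%R.
Proof.
elim/aq_ind=> x; elim/aq_ind=> y; elim/aq_ind=> z.
by rewrite -aqD !aq_mulE mulrDr aqD.
Qed.
HB.instance Definition _ := GRing.Zmodule_isPzRing.Build alg_quot
  aq_mulA aq_mul1l aq_mul1r aq_mulDl aq_mulDr.

Fact aq_scaleA a b u : aq_scale a (aq_scale b u) = aq_scale (a * b) u.
Proof. by elim/aq_ind: u => x; rewrite !aq_scaleE scalerA. Qed.
Fact aq_scale1 : left_id 1 aq_scale.
Proof. by elim/aq_ind=> x; rewrite aq_scaleE scale1r. Qed.
Fact aq_scaleDr : right_distributive aq_scale +%R.
Proof.
move=> a; elim/aq_ind=> x; elim/aq_ind=> y.
by rewrite -aqD !aq_scaleE scalerDr aqD.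
Qed.
Fact aq_scaleDl u : {morph aq_scale^~ u : a b / a + b}.
Proof. by elim/aq_ind: u => x a b; rewrite !aq_scaleE scalerDl aqD. Qed.
HB.instance Definition _ := GRing.Zmodule_isLmodule.Build K alg_quot
  aq_scaleA aq_scale1 aq_scaleDr aq_scaleDl.

Lemma aq1 : aq 1 = 1. Proof. by []. Qed.
Lemma aqM x y : aq (x * y) = aq x * aq y. Proof. by rewrite -aq_mulE. Qed.
Lemma aqZ k x : aq (k *: x) = k *: aq x. Proof. by rewrite -aq_scaleE. Qed.

Fact alg_quot_scalerAl (k : K) (u v : alg_quot) : k *: (u * v) = (k *: u) * v.
Proof.
elim/aq_ind: u => x; elim/aq_ind: v => y.
by rewrite -aqM -!aqZ -aqM scalerAl.
Qed.
Fact alg_quot_scalerAr (k : K) (u v : alg_quot) : k *: (u * v) = u * (k *: v).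
Proof.
elim/aq_ind: u => x; elim/aq_ind: v => y.
by rewrite -aqM -!aqZ -aqM scalerAr.
Qed.
End QuotientAlgebraTheory.

(* The algebra K<X>/(S) presented by generators X and relations s = 0, s in S. *)
Definition presented (K : fieldType) (X : choiceType)
  (S : free_alg K X -> Prop) := alg_quot (A := free_alg K X) S.

Section Presented.
Variables (K : fieldType) (X : choiceType) (S : free_alg K X -> Prop).

HB.instance Definition _ := GRing.PzRing.on (presented S).
HB.instance Definition _ := GRing.Lmodule.on (presented S).

Definition pgen (x : X) : presented S := aq S (gen K x).

Lemma presented_oner_neq0 (f : X -> K) :
  (forall s, S s -> free_eval f s = 0) -> (1 : presented S) != 0.
Proof.
move=> fS; apply/eqP => /aq_eqP; rewrite subr0 => I1.
have: free_eval f 1 = 0.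
  elim: I1 => [|a s b y Ss _ IH]; first exact: free_eval0.
  by rewrite free_evalD !free_evalM (fS s Ss) mulr0 mul0r add0r.
by move/eqP; rewrite free_eval1 oner_eq0.
Qed.

(* The linear map sending x1 * ... * xk to f [:: x1; ...; xk]. It is computed
   on a representative, hence only meaningful when the extension of f to the
   free algebra vanishes on the ideal generated by S (see presented_extE). *)
Definition presented_ext (U : lmodType K) (f : seq X -> U) (u : presented S) : U :=
  word_ext f (repr u).

Lemma presented_extE (U : lmodType K) (f : seq X -> U) :
  (forall a s b, S s -> word_ext f (a * s * b) = 0) ->
  forall g, presented_ext f (aq S g) = word_ext f g.
Proof.
move=> f0 g; apply/eqP; rewrite -subr_eq0 -linearB /=; apply/eqP.
elim: (repr_aq S g) => [|a s b y Ss _ IH]; first exact: linear0.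
by rewrite linearD /= f0 // IH addr0.
Qed.
End Presented.

Section HeckeAlgebra.
Variables (K : fieldType) (q : K) (n : nat).

Local Notation T := (@gen K 'I_n.-1).

(* The generator T_i (1 <= i <= n - 1) has index i - 1 in 'I_n.-1. *)
Inductive hecke_rel : free_alg K 'I_n.-1 -> Prop :=
| hecke_braid (i j : 'I_n.-1) : j = i.+1 :> nat ->
    hecke_rel (T i * T j * T i - T j * T i * T j)
| hecke_comm (i j : 'I_n.-1) : (i.+1 < j)%N ->
    hecke_rel (T i * T j - T j * T i)
| hecke_quad (i : 'I_n.-1) :
    hecke_rel (T i ^+ 2 - ((q - 1) *: T i + q%:A)).

Definition hecke := presented hecke_rel.

Fact hecke_oner_neq0 : (1 : presented hecke_rel) != 0.
Proof.
apply: (@presented_oner_neq0 _ _ _ (fun=> q)) => s [i j _|i j _|i].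
- by rewrite free_evalB !free_evalM !free_eval_gen subrr.
- by rewrite free_evalB !free_evalM !free_eval_gen subrr.
- rewrite expr2 free_evalB free_evalD !free_evalZ free_evalM free_eval1.
  by rewrite !free_eval_gen mulr1 mulrBl mul1r subrK subrr.
Qed.
HB.instance Definition _ := GRing.PzRing.on hecke.
HB.instance Definition _ := GRing.Lmodule.on hecke.
HB.instance Definition _ :=
  GRing.PzSemiRing_isNonZero.Build hecke hecke_oner_neq0.
HB.instance Definition _ :=
  GRing.Lmodule_isLalgebra.Build K hecke (@alg_quot_scalerAl _ _ _).
HB.instance Definition _ :=
  GRing.Lalgebra_isAlgebra.Build K hecke (@alg_quot_scalerAr _ _ _).

Definition hecke_gen (i : 'I_n.-1) : hecke := pgen hecke_rel i.

(* The two sites i, i + 1 on which the i-th generator acts. *)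
Definition site0 (i : 'I_n.-1) : 'I_n := widen_ord (leq_pred n) i.
Fact site1_subproof (i : 'I_n.-1) : (i.+1 < n)%N.
Proof. by rewrite -ltn_predRL. Qed.
Definition site1 (i : 'I_n.-1) : 'I_n := Ordinal (site1_subproof i).

Definition perm_len (w : 'S_n) : nat :=
  #|[set p : 'I_n * 'I_n | (p.1 < p.2)%N && (w p.2 < w p.1)%N]|.

(* A reduced expression of w; the default case does not occur. *)
Definition reduced_word (w : 'S_n) : seq 'I_n.-1 :=
  if [pick t : (perm_len w).-tuple 'I_n.-1 |
        (\prod_(i <- t) tperm (site0 i) (site1 i))%g == w] is Some t
  then t else [::].

Definition hecke_T (w : 'S_n) : hecke := \prod_(i <- reduced_word w) hecke_gen i.
End HeckeAlgebra.

Definition hecke_incl (K : fieldType) (q : K) (n : nat) (h : hecke q n) :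
    hecke q n.+1 :=
  presented_ext
    (fun w => \prod_(i <- w) hecke_gen q (n := n.+1) (widen_ord (leq_pred n) i)) h.

Section Characters.
Variables (K : fieldType) (A : algType K).

Definition is_rep (m : nat) (f : A -> 'M[K]_m) : Prop :=
  [/\ linear f, f 1 = 1%:M & forall a b, f (a * b) = f a *m f b].

(* f a acts on column vectors, so the invariant subspaces are the row spaces
   stable under the transposes. *)
Definition irreducible_rep (m : nat) (f : A -> 'M[K]_m) : Prop :=
  [/\ is_rep f, (0 < m)%N &
      forall U : 'M[K]_m, (forall a, stablemx U (f a)^T) -> U = 0 \/ row_full U].

Definition irreducible_char (chi : A -> K) : Prop :=
  exists (m : nat) (f : A -> 'M[K]_m),
    irreducible_rep f /\ forall a, chi a = \tr (f a).

Definition primitive_idempotent (e : A) : Prop :=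
  [/\ e != 0, e * e = e &
      forall f g : A, f * f = f -> g * g = g -> f * g = 0 -> g * f = 0 ->
        e = f + g -> f = 0 \/ g = 0].
End Characters.

Definition is_partn (n : nat) (lam : seq nat) : bool :=
  [&& sorted geq lam, 0%N \notin lam & sumn lam == n].

Definition removable (lam : seq nat) (i : nat) : bool :=
  (nth 0%N lam i.+1 < nth 0%N lam i)%N.
Definition remove_node (lam : seq nat) (i : nat) : seq nat :=
  [seq p <- set_nth 0%N lam i (nth 0%N lam i).-1 | p != 0%N].

(* chi n lam is the irreducible character of H_n labelled by lam; it is
   unconstrained unless lam is a partition of n. *)
Record standard_labelling (K : fieldType) (q : K)
    (chi : forall n, seq nat -> hecke q n -> K) : Prop := StandardLabelling {
  labelling_irr : forall n lam, is_partn n lam -> irreducible_char (chi n lam);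
  labelling_surj : forall n (f : hecke q n -> K), irreducible_char f ->
    exists2 lam, is_partn n lam & f =1 chi n lam;
  labelling_inj : forall n lam mu, is_partn n lam -> is_partn n mu ->
    chi n lam =1 chi n mu -> lam = mu;
  labelling_branching : forall n lam, is_partn n.+1 lam ->
    forall h : hecke q n, chi n.+1 lam (hecke_incl h) =
      \sum_(i < size lam | removable lam i) chi n (remove_node lam i) h;
  labelling_row : chi 2%N [:: 2%N] (hecke_gen q (n := 2) (@ord0 0)) = q;
  labelling_col : chi 2%N [:: 1%N; 1%N] (hecke_gen q (n := 2) (@ord0 0)) = -1
}.

Definition diagonal_idempotents (K : fieldType) (q : K)
    (chi : forall n, seq nat -> hecke q n -> K)
    (E : forall n, seq nat -> hecke q n) : Prop :=
  forall n lam, is_partn n lam -> primitive_idempotent (E n lam) /\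
    forall mu, is_partn n mu -> chi n mu (E n lam) = (lam == mu)%:R.

(* R i j k l stands for R^{ij}_{kl}. *)
Definition tensor4 (K : Type) (d : nat) := 'I_d -> 'I_d -> 'I_d -> 'I_d -> K.

(* The matrix with rows I and columns J running over the multi-indices
   (i_1, ..., i_n), n.-tuples of elements of 'I_d. *)
Definition multi_mx (A : Type) (d n : nat)
    (F : n.-tuple 'I_d -> n.-tuple 'I_d -> A) : 'M[A]_#|{: n.-tuple 'I_d}| :=
  \matrix_(a, b) F (enum_val a) (enum_val b).

Section HeckeSymmetry.
Variables (K : fieldType) (d : nat) (q : K) (R P : tensor4 K d).

(* The operator R_i on V^{(x) n}. *)
Definition Rop (n : nat) (i : 'I_n.-1) : 'M[K]_#|{: n.-tuple 'I_d}| :=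
  multi_mx (fun I J =>
    R (tnth I (site0 i)) (tnth I (site1 i)) (tnth J (site0 i)) (tnth J (site1 i))
    * \prod_(k < n | (k != site0 i) && (k != site1 i))
        (tnth I k == tnth J k)%:R).

Record hecke_symmetry : Prop := HeckeSymmetry {
  hs_braid : let R1 := Rop (n := 3) (@ord0 1) in let R2 := Rop (n := 3) (@ord_max 1) in
    R1 *m R2 *m R1 = R2 *m R1 *m R2;
  hs_quadratic : let R1 := Rop (n := 2) (@ord0 0) in
    (R1 - q%:M) *m (R1 + 1%:M) = 0;
  hs_closed : forall i j k l,
    \sum_p \sum_s P i p j s * R s k p l = (i == l)%:R * (k == j)%:R
}.

Definition rho (n : nat) : hecke q n -> 'M[K]_#|{: n.-tuple 'I_d}| :=
  presented_ext (fun w => \prod_(i <- w) Rop i).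

Definition antisymmetrizer (n : nat) : 'M[K]_#|{: n.-tuple 'I_d}| :=
  \sum_(w : 'S_n) (- q) ^- perm_len w *: rho (hecke_T q w).

Definition even_of_rank (r : nat) : Prop :=
  antisymmetrizer r != 0 /\ antisymmetrizer r.+1 = 0.

Section Relations.
Variables (X : choiceType) (z t : 'I_d -> 'I_d -> free_alg K X).

Inductive frt_rel : free_alg K X -> Prop :=
| frt_RZZ i j k l :
    frt_rel (\sum_m \sum_n R i j m n *: (z m k * z n l)
             - \sum_p \sum_s R p s k l *: (z i p * z j s)).

Inductive frt_inv_rel : free_alg K X -> Prop :=
| frt_inv_RZZ x : frt_rel x -> frt_inv_rel x
| frt_inv_tz i j : frt_inv_rel (\sum_k t i k * z k j - (i == j)%:R)
| frt_inv_zt i j : frt_inv_rel (\sum_k z i k * t k j - (i == j)%:R).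

Variable f : X -> K.
Hypothesis fz : forall i j, free_eval f (z i j) = (i == j)%:R.
Hypothesis ft : forall i j, free_eval f (t i j) = (i == j)%:R.

Let sum_delta (F : 'I_d -> K) k : \sum_m F m * (m == k)%:R = F k.
Proof.
rewrite (bigD1 k) //= eqxx mulr1 big1 ?addr0 // => m /negPf ->.
by rewrite mulr0.
Qed.

Fact frt_rel_point s : frt_rel s -> free_eval f s = 0.
Proof.
case=> i j k l; rewrite free_evalB; apply/eqP; rewrite subr_eq0.
apply/eqP; transitivity (R i j k l).
  rewrite free_eval_sum.
  transitivity (\sum_m R i j m l * (m == k)%:R); last exact: sum_delta.
  apply: eq_bigr => m _.
  rewrite free_eval_sum -(sum_delta (fun n => R i j m n * (m == k)%:R) l).
  by apply: eq_bigr => n _; rewrite free_evalZ free_evalM !fz mulrA.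
rewrite free_eval_sum.
transitivity (\sum_p R p j k l * (p == i)%:R); first by rewrite sum_delta.
apply: eq_bigr => p _.
rewrite free_eval_sum -(sum_delta (fun u => R p u k l * (p == i)%:R) j).
apply: eq_bigr => u _; rewrite free_evalZ free_evalM !fz mulrA.
by rewrite (eq_sym i) (eq_sym j).
Qed.

Fact frt_inv_rel_point s : frt_inv_rel s -> free_eval f s = 0.
Proof.
have aux (u v : 'I_d -> 'I_d -> free_alg K X) i j :
    (forall k l, free_eval f (u k l) = (k == l)%:R) ->
    (forall k l, free_eval f (v k l) = (k == l)%:R) ->
    free_eval f (\sum_k u i k * v k j - (i == j)%:R) = 0.
  move=> Hu Hv; rewrite free_evalB free_eval_sum free_eval_nat.
  rewrite -(sum_delta (fun k => (i == k)%:R) j); apply/eqP; rewrite subr_eq0.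
  by apply/eqP/eq_bigr => k _; rewrite free_evalM Hu Hv.
by case=> [x /frt_rel_point //|i j|i j]; apply: aux.
Qed.
End Relations.

(* E_R and H_R: the generator z^i_j of E_R is indexed by (i, j); in H_R, inl (i, j) stands
   for z^i_j and inr (i, j) for t^i_j. *)
Definition E_rel : free_alg K ('I_d * 'I_d)%type -> Prop :=
  frt_rel (fun i j => gen K (i, j)).
Definition H_rel : free_alg K ('I_d * 'I_d + 'I_d * 'I_d)%type -> Prop :=
  frt_inv_rel (fun i j => gen K (inl (i, j))) (fun i j => gen K (inr (i, j))).

Definition E_alg := presented E_rel.
Definition H_alg := presented H_rel.

Fact E_oner_neq0 : (1 : presented E_rel) != 0.
Proof.
apply: (@presented_oner_neq0 _ _ _ (fun x => (x.1 == x.2)%:R)) => s.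
by apply: frt_rel_point => i j; rewrite free_eval_gen.
Qed.
HB.instance Definition _ := GRing.PzRing.on E_alg.
HB.instance Definition _ := GRing.Lmodule.on E_alg.
HB.instance Definition _ :=
  GRing.PzSemiRing_isNonZero.Build E_alg E_oner_neq0.
HB.instance Definition _ :=
  GRing.Lmodule_isLalgebra.Build K E_alg (@alg_quot_scalerAl _ _ _).
HB.instance Definition _ :=
  GRing.Lalgebra_isAlgebra.Build K E_alg (@alg_quot_scalerAr _ _ _).

Fact H_oner_neq0 : (1 : presented H_rel) != 0.
Proof.
apply: (@presented_oner_neq0 _ _ _
  (fun x => match x with inl y | inr y => (y.1 == y.2)%:R end)) => s.
by apply: frt_inv_rel_point => i j; rewrite free_eval_gen.
Qed.
HB.instance Definition _ := GRing.PzRing.on H_alg.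
HB.instance Definition _ := GRing.Lmodule.on H_alg.
HB.instance Definition _ :=
  GRing.PzSemiRing_isNonZero.Build H_alg H_oner_neq0.
HB.instance Definition _ :=
  GRing.Lmodule_isLalgebra.Build K H_alg (@alg_quot_scalerAl _ _ _).
HB.instance Definition _ :=
  GRing.Lalgebra_isAlgebra.Build K H_alg (@alg_quot_scalerAr _ _ _).

Definition Hz (i j : 'I_d) : H_alg := pgen H_rel (inl (i, j)).

(* The canonical map E_R -> H_R. *)
Definition E_to_H : E_alg -> H_alg :=
  presented_ext (fun w => \prod_(x <- w) Hz x.1 x.2).

Definition Dmx (i j : 'I_d) : K := \sum_l P l i l j.

Definition Dpow (n : nat) : 'M[K]_#|{: n.-tuple 'I_d}| :=
  multi_mx (fun I J => \prod_(k < n) Dmx (tnth I k) (tnth J k)).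
Definition Zpow (n : nat) : 'M[H_alg]_#|{: n.-tuple 'I_d}| :=
  multi_mx (fun I J => \prod_(k < n) Hz (tnth I k) (tnth J k)).

(* qh is the chosen square root of q, so qh ^+ (n * r.+1) is q^(n(r+1)/2). *)
Variables (qh : K) (r : nat).

Definition Phi (n : nat) (F : 'M[K]_#|{: n.-tuple 'I_d}|) : H_alg :=
  qh ^+ (n * r.+1) *: \tr (map_mx (fun c => c%:A) (Dpow n *m F) *m Zpow n).

Variable E : forall n, seq nat -> hecke q n.

Definition S_ (lam : seq nat) : H_alg :=
  if lam is [::] then 1 else Phi (rho (E (sumn lam) lam)).

(* The linear span in H_R of the S_lam, lam with at most r parts. *)
Definition Lambda (x : H_alg) : Prop :=
  exists s : seq (K * seq nat),
    (forall p, p \in s -> is_partn (sumn p.2) p.2 /\ (size p.2 <= r)%N) /\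
    x = \sum_(p <- s) p.1 *: S_ p.2.
End HeckeSymmetry.

Arguments Lambda {K d q} R P qh r E x.

Definition is_subalgebra (K : fieldType) (A : algType K) (S : A -> Prop) : Prop :=
  [/\ S 1, forall (a : K) u v, S u -> S v -> S (a *: u + v)
    & forall u v, S u -> S v -> S (u * v)].

(* Main.v *)
(* The expansion of Phi along the characters needs no semisimplicity of H_n:
   Z^{(x) n} commutes with the R_i, so it is a combination sum_a z_a B_a of
   matrices B_a over K commuting with rho(H_n). D^{(x) n} also commutes with
   rho(H_n), because of the two identities D_1 P_12 = S_21 D_2 and
   P_12 D_1 = D_2 S_21 with S = R^{-1}, which come from the braid relation. Hence
   Phi(rho(h)) is a trace, equal to sum_a z_a tr(rho(h) B_a D^{(x) n}) up to the
   power of q^{1/2}. For B commuting with rho(H_n), splitting off eigenspaces of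
   B shows that h |-> tr(rho(h) B) is a combination of the irreducible characters
   occurring in V^{(x) n}, so that
   Phi(rho(h)) = sum_lambda chi^lambda(h) Phi(rho(E_lambda)).

   If rho kills an element on which chi^lambda does not vanish, then chi^lambda
   does not occur and rho(E_lambda) = 0. For lambda = (1^(r+1)) that element is
   the antisymmetrizer, where the sign character takes the value
   sum_w q^{-l(w)}, nonzero by the product formula for this sum. For a longer
   lambda it is the image of E_(1^(r+1)) in H_n: an idempotent, so its
   characters are natural numbers and cannot cancel in the branching rule.
   Finally Phi(F) Phi(G) = Phi(F (x) G) makes the span of the S_lambda a
   subalgebra. *)
Require Import Defs.
From mathcomp Require Import all_boot all_order all_fingroup all_algebra.
From mathcomp Require Import finmap boolp mxrepresentation.
From mathcomp Require Import zify.
From mathcomp.multinomials Require Import monalg.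

Set Implicit Arguments.
Unset Strict Implicit.
Unset Printing Implicit Defensive.

Import GRing.Theory.
Local Open Scope ring_scope.

(** * Traces of operators commuting with a representation *)

(** In the rank factorization A = C B, idempotence forces B C = 1, so tr (C B) = tr (B C) is the
    trace of an identity matrix of size [\rank A]. *)
Lemma mxtrace_idempotent (K : fieldType) N (A : 'M[K]_N) :
  A *m A = A -> \tr A = (\rank A)%:R.
Proof.
move=> AA; have rc1 : row_base A *m col_base A = 1%:M.
  apply: (row_free_inj (row_base_free A)); rewrite mul1mx.
  apply: (row_full_inj (col_base_full A)).
  by rewrite mulmxA (mulmxA (col_base A)) !mulmx_base -mulmxA mulmx_base.
by rewrite -{1}(mulmx_base A) mxtrace_mulC rc1 mxtrace1.
Qed.

Section SubFactor.
Variables (K : fieldType) (N : nat) (U : 'M[K]_N).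

(** [sub_endo] and [fact_endo] are the maps induced by [X] on the row space of [U] and on the
    quotient by it. Being defined for every [X], they are linear in [X]; stability of [U] enters
    with multiplicativity. *)
Definition sub_endo (X : 'M[K]_N) : 'M[K]_(\rank U) :=
  in_submod U (val_submod 1%:M *m X).
Definition fact_endo (X : 'M[K]_N) : 'M[K]_(\rank (cokermx U)) :=
  in_factmod U (val_factmod 1%:M *m X).

Lemma sub_endo_linear : linear sub_endo.
Proof. by move=> a X Y; rewrite /sub_endo mulmxDr -scalemxAr linearP. Qed.
Lemma fact_endo_linear : linear fact_endo.
Proof. by move=> a X Y; rewrite /fact_endo mulmxDr -scalemxAr linearP. Qed.

Lemma sub_endo1 : sub_endo 1%:M = 1%:M.
Proof. by rewrite /sub_endo mulmx1 val_submodK. Qed.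
Lemma fact_endo1 : fact_endo 1%:M = 1%:M.
Proof. by rewrite /fact_endo mulmx1 val_factmodK. Qed.

Lemma sub_endoM X Y : stablemx U X ->
  sub_endo (X *m Y) = sub_endo X *m sub_endo Y.
Proof.
move=> UX; rewrite {1}/sub_endo mulmxA [RHS]mulmxA.
congr (in_submod U _); rewrite mulmxA -val_submodE in_submodK //.
by apply: submx_trans UX; rewrite submxMr ?val_submodP.
Qed.

(** Row vectors meet [X] first. The component that [X] sends into [U] is kept in [U] by [Y] and dies
    in the quotient, so stability is asked of [Y] here and of [X] in [sub_endoM]. *)
Lemma fact_endoM X Y : stablemx U Y ->
  fact_endo (X *m Y) = fact_endo X *m fact_endo Y.
Proof.
move=> UY; rewrite {1}/fact_endo mulmxA.
rewrite -{1}[_ *m X](add_sub_fact_mod U) mulmxDl linearD /=.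
apply: (canLR (subrK _)); apply: etrans (_ : 0 = _).
  apply/eqP; rewrite in_factmod_eq0; apply: submx_trans UY.
  by rewrite submxMr ?val_submodP.
by rewrite /fact_endo /in_factmod /val_factmod /= !mulmxA mulmx1 ?subrr.
Qed.

(** Cyclicity rewrites the two traces as those of [X] composed with the projections onto [U] and
    onto a complement, which add up to the identity. *)
Lemma mxtrace_sub_fact_endo X : \tr X = \tr (sub_endo X) + \tr (fact_endo X).
Proof.
rewrite -[sub_endo X]mulmxA mxtrace_mulC -val_submodE addrC.
rewrite -[fact_endo X]mulmxA mxtrace_mulC -val_factmodE addrC.
by rewrite -mxtraceD add_sub_fact_mod.
Qed.
End SubFactor.

Lemma eigenvalue_exists (K : closedFieldType) N (X : 'M[K]_N) :
  (0 < N)%N -> exists c, eigenvalue X c.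
Proof.
move=> N0; have /closed_rootP[c rc] : size (char_poly X) != 1.
  by rewrite size_char_poly eqSS -lt0n.
by exists c; rewrite eigenvalue_root_char.
Qed.

Lemma is_rep0 (K : fieldType) (A : algType K) N (f : A -> 'M[K]_N) :
  is_rep f -> f 0 = 0.
Proof. by case=> lf _ _; have := lf (-1) 0 0; rewrite scaleN1r addNr scaleN1r addNr. Qed.

(* Split off an eigenspace of B whenever it is proper; otherwise B is scalar,
   and a proper submodule, if any, is then also stable under B. *)
Lemma commuting_trace_ind (K : closedFieldType) (A : algType K)
    (P : (A -> K) -> Prop) N (f : A -> 'M[K]_N) (B : 'M[K]_N) :
    P (fun=> 0) -> (forall u v, P u -> P v -> P (fun a => u a + v a)) ->
    (forall c chi, irreducible_char chi -> (forall a, f a = 0 -> chi a = 0) ->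
       P (fun a => c * chi a)) ->
    is_rep f -> (forall a, f a *m B = B *m f a) ->
  P (fun a => \tr (f a *m B)).
Proof.
move=> P0 PD; have [m] := ubnP N; elim: m N f B => // m IHm N f B.
rewrite ltnS => le_Nm Pirr rf fB; have [lf f1 fM] := rf.
have [N0|N_gt0] := posnP N.
  suff -> : (fun a => \tr (f a *m B)) = (fun=> 0) by [].
  by apply: funext => a; subst N; rewrite flatmx0 mxtrace0.
have [[U [Uf UB nzU nfU]]|noU] := pselect (exists U : 'M[K]_N,
  [/\ forall a, stablemx U (f a)^T, stablemx U B^T, U != 0 & ~~ row_full U]).
  (* [h] stands for [sub_endo U] or [fact_endo U]. Transposing before and after [h] yields a
     representation on columns of smaller dimension, commuting with the map induced by [B]; its
     kernel contains that of [f]. *)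
  have part k (h : 'M[K]_N -> 'M[K]_k) : (k < N)%N -> linear h ->
      h 1%:M = 1%:M ->
      (forall X Y, stablemx U X -> stablemx U Y -> h (X *m Y) = h X *m h Y) ->
      P (fun a => \tr (h (B^T *m (f a)^T))).
    move=> lt_kN lh h1 hM.
    have h0 : h 0 = 0 by have := lh (-1) 0 0; rewrite scaleN1r addNr scaleN1r addNr.
    have -> : (fun a => \tr (h (B^T *m (f a)^T))) =
              (fun a => \tr ((h (f a)^T)^T *m (h B^T)^T)).
      by apply: funext => a; rewrite hM // -trmx_mul mxtrace_tr.
    apply: IHm.
    - exact: leq_trans lt_kN le_Nm.
    - move=> c chi irr van; apply: Pirr => // a fa0; apply: van.
      by rewrite fa0 trmx0 h0 trmx0.
    - split=> [c a b||a b]; first by rewrite lf linearP lh linearP.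
        by rewrite f1 trmx1 h1 trmx1.
      by rewrite fM trmx_mul hM // trmx_mul.
    - by move=> a; rewrite -!trmx_mul -!hM // -!trmx_mul fB.
  have -> : (fun a => \tr (f a *m B)) = fun a =>
      \tr (sub_endo U (B^T *m (f a)^T)) + \tr (fact_endo U (B^T *m (f a)^T)).
    by apply: funext => a; rewrite -mxtrace_sub_fact_endo -trmx_mul mxtrace_tr.
  have ltU : (\rank U < N)%N.
    by rewrite ltn_neqAle rank_leq_row andbT; move: nfU; rewrite /row_full.
  apply: PD; apply: part.
  - exact: ltU.
  - exact: sub_endo_linear.
  - exact: sub_endo1.
  - by move=> X Y UX _; apply: sub_endoM.
  - by rewrite mxrank_coker ltn_subrL lt0n mxrank_eq0 nzU.
  - exact: fact_endo_linear.
  - exact: fact_endo1.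
  - by move=> X Y _; apply: fact_endoM.
(* An eigenspace of [B^T] is nonzero and stable under [B^T] and all [(f a)^T], so it is the whole
   space and [B] is scalar. *)
have [c eig_c] := eigenvalue_exists B^T N_gt0.
have Bc : B = c%:M.
  apply: trmx_inj; rewrite tr_scalar_mx; apply/eqP; rewrite -subr_eq0.
  have [full|nfull] := boolP (row_full (eigenspace B^T c)).
    apply/eqP; apply: (row_full_inj full); rewrite mulmx0.
    by rewrite mulmx_ker.
  case: noU; exists (eigenspace B^T c); split=> //.
    by move=> a; apply: comm_mx_stable_eigenspace; rewrite /comm_mx -!trmx_mul fB.
  exact: comm_mx_stable_eigenspace.
have -> : (fun a => \tr (f a *m B)) = (fun a => c * \tr (f a)).
  by apply: funext => a; rewrite Bc mul_mx_scalar mxtraceZ.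
apply: (Pirr c (fun a => \tr (f a))) => [|a ->]; last by rewrite mxtrace0.
exists N, f; split=> //; split=> // U Uf.
have [->|nzU] := eqVneq U 0; first by left.
right; apply/negPn/negP => nfU; case: noU; exists U; split=> //.
by rewrite Bc tr_scalar_mx mul_mx_scalar scalemx_sub.
Qed.

(* The coefficients come from the projection [1 - A *m pinvmx A] onto the
   left kernel of the coefficient matrix. *)
Lemma linear_system_param (K : fieldType) (J L : finType) (V : lmodType K)
    (A : J -> L -> K) (z : J -> V) :
    (forall l, \sum_j A j l *: z j = 0) ->
  exists C : J -> J -> K, (forall i l, \sum_j C i j * A j l = 0) /\
    forall j, z j = \sum_i C i j *: z i.
Proof.
move=> zA; pose M : 'M[K]_(#|J|, #|L|) := \matrix_(a, b) A (enum_val a) (enum_val b).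
pose C := 1%:M - M *m pinvmx M.
have CM : C *m M = 0 by rewrite mulmxBl mul1mx mulmxKpV ?subrr // submx_refl.
exists (fun i j => C (enum_rank i) (enum_rank j)); split=> [i l|j].
  transitivity ((C *m M) (enum_rank i) (enum_rank l)); last by rewrite CM mxE.
  rewrite mxE (reindex (@enum_rank J)) /=; last first.
    by exists enum_val => x _; [apply: enum_rankK | apply: enum_valK].
  by apply: eq_bigr => k _; rewrite [M _ _]mxE !enum_rankK.
have CE i : C (enum_rank i) (enum_rank j) =
    (i == j)%:R - \sum_l A i l * pinvmx M (enum_rank l) (enum_rank j).
  rewrite 3!mxE [X in _ - X]mxE (inj_eq enum_rank_inj); congr (_ - _).
  rewrite (reindex (@enum_rank L)) /=; last first.
    by exists enum_val => x _; [apply: enum_rankK | apply: enum_valK].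
  by apply: eq_bigr => l _; rewrite mxE !enum_rankK.
under eq_bigr => i _ do rewrite CE scalerBl scaler_suml.
rewrite sumrB exchange_big /= [X in _ - X]big1 ?subr0 => [|l _]; last first.
  transitivity (pinvmx M (enum_rank l) (enum_rank j) *: \sum_i A i l *: z i).
    by rewrite scaler_sumr; apply: eq_bigr => i _; rewrite scalerA mulrC.
  by rewrite zA scaler0.
rewrite (bigD1 j) //= eqxx scale1r big1 ?addr0 // => i /negPf->.
by rewrite scale0r.
Qed.

(** * Algebras given by generators and relations *)

Lemma free_alg_ind (K : fieldType) (X : choiceType) (P : free_alg K X -> Prop) :
    (forall w : seq X, P (\prod_(x <- w) gen K x)) ->
    (forall a u v, P u -> P v -> P (a *: u + v)) -> forall g, P g.
Proof.
move=> Pw PD g.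
have P0 : P 0.
  by have := PD (-1) _ _ (Pw [::]) (Pw [::]); rewrite scaleN1r addNr.
have Pm c (m : {fmonom X}) : P (mkmalgU m c).
  have -> : mkmalgU m c = c *: \prod_(x <- (m : seq X)) gen K x + 0 :> free_alg K X.
    have -> : \prod_(x <- (m : seq X)) gen K x = mkmalgU m 1.
      have -> : m = fmonom_of_seq fmonom_key m by apply/eqP; rewrite fmP !fmE.
      rewrite {1}fmE; elim: (m : seq X) => [|x w IH].
        by rewrite big_nil; congr (mkmalgU _ _); apply/eqP; rewrite fmP fm1 fmE.
      rewrite big_cons IH gen.unlock free_algME malgM_def fgmulUU mulr1.
      by congr (mkmalgU _ _); apply/eqP; rewrite fmP fmM fmU !fmE.
    by rewrite addr0 free_algZE; apply/malgP => k; rewrite mcoeffZ !mcoeffU mulrnAr mulr1.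
  exact: PD.
rewrite [g]monalgE; elim: (finmap.enum_fset _) => [|m s IH].
  by rewrite big_nil.
by rewrite big_cons; have := PD 1 _ _ (Pm (mcoeff m g) m) IH; rewrite scale1r.
Qed.

(** Words span the algebra and arise from 1 by left multiplication with generators. This is the form
    of induction used on elements of the Hecke algebra. *)
Lemma presented_ind (K : fieldType) (X : choiceType) (S : free_alg K X -> Prop)
    (P : presented S -> Prop) :
    P 1 -> (forall a u v, P u -> P v -> P (a *: u + v)) ->
    (forall x u, P u -> P (pgen S x * u)) -> forall u, P u.
Proof.
move=> P1 PD PM; apply: aq_ind; apply: free_alg_ind => [w|a u v Pu Pv].
  elim: w => [|x w IH]; first by rewrite big_nil.
  by rewrite big_cons aqM; apply: PM.
by rewrite aqD aqZ; apply: PD.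
Qed.

(* Extending a word map multiplicative for [mul]; [U] with [mul] may be a ring
   of square matrices of size 0, which is not an [algType]. *)
Section PresentedMorphism.
Variables (K : fieldType) (X : choiceType) (S : free_alg K X -> Prop).
Variables (U : lmodType K) (mul : U -> U -> U) (f : seq X -> U).
Hypothesis mul_linl : forall v, linear (mul^~ v).
Hypothesis mul_linr : forall u, linear (mul u).
Hypothesis f_cat : forall s t, f (s ++ t) = mul (f s) (f t).

Let word_extM g h : word_ext f (g * h) = mul (word_ext f g) (word_ext f h).
Proof.
elim/free_alg_ind: g => [s|a g1 g2 IH1 IH2].
  elim/free_alg_ind: h => [t|a h1 h2 IH1 IH2].
    by rewrite -big_cat !word_ext_word f_cat.
  by rewrite mulrDr -scalerAr !(word_ext_is_linear f) IH1 IH2 mul_linr.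
by rewrite mulrDl -scalerAl !(word_ext_is_linear f) IH1 IH2 mul_linl.
Qed.

Hypothesis fS : forall s, S s -> word_ext f s = 0.

(** For multiplicative [f], vanishing on the relations already gives vanishing on the two-sided
    ideal, so the value does not depend on the representative. *)
Lemma presented_ext_aq g : presented_ext f (aq S g) = word_ext f g.
Proof.
apply: presented_extE => a s b Ss; rewrite !word_extM (fS Ss).
rewrite [mul (word_ext f a) 0](_ : _ = 0); last first.
  by have := mul_linr (word_ext f a) (-1) 0 0; rewrite !scaleN1r !addNr.
by have /= := mul_linl (word_ext f b) (-1) 0 0; rewrite !scaleN1r !addNr.
Qed.

Lemma presented_ext_linear : linear (presented_ext (S := S) f).
Proof.
move=> a; elim/aq_ind=> g; elim/aq_ind=> h.
by rewrite -aqZ -aqD !presented_ext_aq word_ext_is_linear.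
Qed.

Lemma presented_extM u v :
  presented_ext (S := S) f (u * v) = mul (presented_ext f u) (presented_ext f v).
Proof.
elim/aq_ind: u => g; elim/aq_ind: v => h.
by rewrite -aqM !presented_ext_aq word_extM.
Qed.

Lemma presented_ext_word w :
  presented_ext (S := S) f (\prod_(x <- w) pgen S x) = f w.
Proof.
have -> : \prod_(x <- w) pgen S x = aq S (\prod_(x <- w) gen K x).
  by elim: w => [|x w IH]; rewrite ?big_nil // !big_cons aqM IH.
by rewrite presented_ext_aq word_ext_word.
Qed.
End PresentedMorphism.

(** * Operators acting on selected tensor factors *)

Section MultiIndex.
Variables (d : nat).
Local Notation T n := (n.-tuple 'I_d).

Definition mxe (A : Type) n (F : 'M[A]_#|{: T n}|) (I J : T n) : A :=
  F (enum_rank I) (enum_rank J).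

Lemma mxeP (A : Type) n (F G : 'M[A]_#|{: T n}|) :
  (forall I J, mxe F I J = mxe G I J) -> F = G.
Proof.
move=> FG; apply/matrixP => a b; have := FG (enum_val a) (enum_val b).
by rewrite /mxe !enum_valK.
Qed.

Lemma mxe_multi (A : Type) n (f : T n -> T n -> A) I J :
  mxe (multi_mx f) I J = f I J.
Proof. by rewrite /mxe mxE !enum_rankK. Qed.

Lemma sum_enum_rank (V : nmodType) n (f : 'I_#|{: T n}| -> V) :
  \sum_a f a = \sum_(I : T n) f (enum_rank I).
Proof.
rewrite (reindex (@enum_rank (T n))) //.
by exists enum_val => x _; [apply: enum_rankK | apply: enum_valK].
Qed.

Lemma mxeM (A : pzSemiRingType) n (F G : 'M[A]_#|{: T n}|) I J :
  mxe (F *m G) I J = \sum_L mxe F I L * mxe G L J.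
Proof. by rewrite /mxe mxE sum_enum_rank. Qed.

Lemma mxe1 (A : pzSemiRingType) n I J :
  mxe (1%:M : 'M[A]_#|{: T n}|) I J = (I == J)%:R.
Proof. by rewrite /mxe mxE (inj_eq enum_rank_inj). Qed.

Lemma mxeD (A : nmodType) n (F G : 'M[A]_#|{: T n}|) I J :
  mxe (F + G) I J = mxe F I J + mxe G I J.
Proof. by rewrite /mxe mxE. Qed.

Lemma mxeB (A : zmodType) n (F G : 'M[A]_#|{: T n}|) I J :
  mxe (F - G) I J = mxe F I J - mxe G I J.
Proof. by rewrite /mxe !mxE. Qed.

Lemma mxeZ (A : pzRingType) n a (F : 'M[A]_#|{: T n}|) I J :
  mxe (a *: F) I J = a * mxe F I J.
Proof. by rewrite /mxe mxE. Qed.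

Lemma mxtrace_mxe (A : nmodType) n (F : 'M[A]_#|{: T n}|) :
  \tr F = \sum_I mxe F I I.
Proof. exact: sum_enum_rank. Qed.

Section Sites.
Variables (n k : nat) (s : 'I_k -> 'I_n).

Definition sel (I : T n) : T k := [tuple tnth I (s a) | a < k].

Definition off (I J : T n) : bool :=
  [forall j, (j \notin codom s) ==> (tnth I j == tnth J j)].

Definition put (I : T n) (L : T k) : T n :=
  [tuple if [pick a | s a == j] is Some a then tnth L a else tnth I j | j < n].

Lemma offP I J :
  reflect (forall j, j \notin codom s -> tnth I j = tnth J j) (off I J).
Proof. by apply: (iffP 'forall_implyP) => H j /H; move/eqP. Qed.

Lemma off_sym I J : off I J = off J I.
Proof. by apply/offP/offP => H j /H. Qed.

Lemma tnth_sel I a : tnth (sel I) a = tnth I (s a).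
Proof. exact: tnth_mktuple. Qed.

Lemma put_out I L j : j \notin codom s -> tnth (put I L) j = tnth I j.
Proof.
move=> js; rewrite tnth_mktuple; case: pickP => // a /eqP ja.
by rewrite -ja codom_f in js.
Qed.

Lemma off_put I L J : off (put I L) J = off I J.
Proof. by apply/offP/offP => H j js; rewrite -H // put_out. Qed.

Lemma eq_sel_off I J : off I J -> sel I = sel J -> I = J.
Proof.
move=> /offP IJ eIJ; apply: eq_from_tnth => j.
have [/codomP[a ->]|js] := boolP (j \in codom s); last exact: IJ.
by rewrite -!tnth_sel eIJ.
Qed.

Hypothesis s_inj : injective s.

Lemma put_in I L a : tnth (put I L) (s a) = tnth L a.
Proof.
rewrite tnth_mktuple; case: pickP => [b /eqP /s_inj -> //|/(_ a)].
by rewrite eqxx.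
Qed.

Lemma sel_put I L : sel (put I L) = L.
Proof. by apply: eq_from_tnth => a; rewrite tnth_sel put_in. Qed.

(** [put I] and [sel] are inverse bijections between the short multi-indices and those that agree
    with [I] off the sites. *)
Lemma sum_off (V : nmodType) I (f : T n -> V) :
  \sum_(L | off I L) f L = \sum_L f (put I L).
Proof.
rewrite (reindex_onto (put I) sel) => [|L IL].
  apply: eq_bigl => L; rewrite sel_put eqxx andbT off_sym off_put.
  by apply/offP.
apply: eq_sel_off; rewrite ?sel_put // off_put //.
Qed.
End Sites.
End MultiIndex.

(* [loc s M] is the operator M acting on the tensor factors s 0, ..., s (k-1). *)
Section LocalOperators.
Variables (K : fieldType) (d : nat).
Local Notation T n := (n.-tuple 'I_d).
Local Notation Mat n := 'M[K]_#|{: n.-tuple 'I_d}|.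

Definition loc n k (s : 'I_k -> 'I_n) (M : Mat k) : Mat n :=
  multi_mx (fun I J => (off s I J)%:R * mxe M (sel s I) (sel s J)).

Lemma mxe_loc n k (s : 'I_k -> 'I_n) M I J :
  mxe (loc s M) I J = (off s I J)%:R * mxe M (sel s I) (sel s J).
Proof. exact: mxe_multi. Qed.

Lemma eq_loc n k (s t : 'I_k -> 'I_n) M : s =1 t -> loc s M = loc t M.
Proof. by move=> /funext->. Qed.

Lemma loc_linear n k (s : 'I_k -> 'I_n) : linear (loc s).
Proof.
move=> a M N; apply: mxeP => I J; rewrite !(mxeD, mxeZ, mxe_loc).
by rewrite mulrDr mulrCA.
Qed.

Lemma loc0 n k (s : 'I_k -> 'I_n) : loc s 0 = 0.
Proof. by have := loc_linear s (-1) 0 0; rewrite scaleN1r addNr scaleN1r addNr. Qed.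

Lemma locD n k (s : 'I_k -> 'I_n) M N : loc s (M + N) = loc s M + loc s N.
Proof. by have := loc_linear s 1 M N; rewrite !scale1r. Qed.

Lemma locZ n k (s : 'I_k -> 'I_n) a M : loc s (a *: M) = a *: loc s M.
Proof. by have := loc_linear s a M 0; rewrite !addr0 loc0 addr0. Qed.

(** A local operator changes only the selected coordinates. The summands lie in an arbitrary module,
    so that the formula serves matrix products over [K] as well as sums of products in an algebra
    such as H_R. *)
Lemma sum_locl (V : lmodType K) n k (s : 'I_k -> 'I_n) M I (f : T n -> V) :
  injective s -> \sum_L mxe (loc s M) I L *: f L =
                 \sum_L mxe M (sel s I) L *: f (put s I L).
Proof.
move=> s_inj; under eq_bigr => L _ do rewrite mxe_loc.
rewrite (bigID (off s I)) /= [X in _ + X]big1 ?addr0 => [|L /negPf->]; last first.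
  by rewrite mul0r scale0r.
rewrite sum_off //; apply: eq_bigr => L _.
by rewrite off_sym off_put sel_put // (_ : off s I I) ?mul1r //; apply/offP.
Qed.

Lemma sum_locr (V : lmodType K) n k (s : 'I_k -> 'I_n) M J (f : T n -> V) :
  injective s -> \sum_L mxe (loc s M) L J *: f L =
                 \sum_L mxe M L (sel s J) *: f (put s J L).
Proof.
move=> s_inj; under eq_bigr => L _ do rewrite mxe_loc off_sym.
rewrite (bigID (off s J)) /= [X in _ + X]big1 ?addr0 => [|L /negPf->]; last first.
  by rewrite mul0r scale0r.
rewrite sum_off //; apply: eq_bigr => L _.
by rewrite off_sym off_put sel_put // (_ : off s J J) ?mul1r //; apply/offP.
Qed.

Lemma locM n k (s : 'I_k -> 'I_n) M N : injective s ->
  loc s (M *m N) = loc s M *m loc s N.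
Proof.
move=> s_inj; apply: mxeP => I J; rewrite mxe_loc !mxeM mulr_sumr.
rewrite (sum_locl (V := K^o) M I (fun L => mxe (loc s N) L J)) //.
apply: eq_bigr => L _; rewrite /GRing.scale /= mxe_loc sel_put // off_put.
by rewrite mulrCA.
Qed.

Lemma loc1 n k (s : 'I_k -> 'I_n) : loc s 1%:M = 1%:M.
Proof.
apply: mxeP => I J; rewrite mxe_loc !mxe1 -natrM mulnb; congr (_%:R); congr nat_of_bool.
apply/andP/eqP => [[IJ /eqP]|->]; first exact: eq_sel_off.
by rewrite eqxx; split=> //; apply/offP.
Qed.

Lemma loc_comp n m k (s : 'I_m -> 'I_n) (t : 'I_k -> 'I_m) M : injective s ->
  loc s (loc t M) = loc (s \o t) M.
Proof.
move=> s_inj; apply: mxeP => I J; rewrite !mxe_loc mulrA -natrM mulnb.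
have selE L : sel t (sel s L) = sel (s \o t) L.
  by apply: eq_from_tnth => a; rewrite !tnth_sel.
rewrite !selE; congr (_%:R * _); congr nat_of_bool.
apply/andP/offP => [[/offP s_off /offP t_off] j jst|st_off].
  have [/codomP[a ja]|] := boolP (j \in codom s); last exact: s_off.
  rewrite ja -!tnth_sel; apply: t_off; apply: contra jst => /codomP[b ab].
  by rewrite ja ab; apply: (codom_f (s \o t)).
split; apply/offP => j js.
  apply: st_off; apply: contra js => /codomP[a ->]; exact: codom_f.
rewrite !tnth_sel; apply: st_off; apply: contra js => /codomP[a /s_inj ->].
exact: codom_f.
Qed.

(** The middle index of the product is forced: it agrees with [J] on the sites of [s] and with [I]
    elsewhere. The resulting formula is symmetric in the two operators, which gives
    [loc_commute]. *)
Lemma mxe_loc_disjoint n k l (s : 'I_k -> 'I_n) (t : 'I_l -> 'I_n) M N I J :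
    injective s -> (forall a b, s a != t b) ->
  mxe (loc s M *m loc t N) I J =
  [forall j, (j \notin codom s) && (j \notin codom t) ==> (tnth I j == tnth J j)]%:R
    * (mxe M (sel s I) (sel s J) * mxe N (sel t I) (sel t J)).
Proof.
move=> s_inj st; have ts b : t b \notin codom s.
  by apply/codomP => -[a tb]; have := st a b; rewrite tb eqxx.
have s't a : s a \notin codom t.
  by apply/codomP => -[b sa]; have := st a b; rewrite sa eqxx.
rewrite mxeM (sum_locl (V := K^o) M I (fun L => mxe (loc t N) L J)) //.
have selE L : sel t (put s I L) = sel t I.
  by apply: eq_from_tnth => b; rewrite !tnth_sel put_out.
rewrite (bigD1 (sel s J)) //= big1 ?addr0 => [|L nL]; last first.
  rewrite mxe_loc (_ : off _ _ _ = false) ?mul0r ?scaler0 //.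
  apply/negP => /offP offL; case/eqP: nL; apply: eq_from_tnth => a.
  by rewrite tnth_sel -offL // put_in.
rewrite /GRing.scale /= mxe_loc selE mulrCA; congr (_%:R * _).
congr nat_of_bool; apply/offP/forallP => [H j|H j jt].
  by apply/implyP => /andP[js jt]; rewrite -H // put_out.
have [/codomP[a ->]|js] := boolP (j \in codom s).
  by rewrite put_in // tnth_sel.
by rewrite put_out //; apply/eqP; have /implyP := H j; apply; rewrite js.
Qed.

Lemma loc_commute n k l (s : 'I_k -> 'I_n) (t : 'I_l -> 'I_n) M N :
    injective s -> injective t -> (forall a b, s a != t b) ->
  loc s M *m loc t N = loc t N *m loc s M.
Proof.
move=> s_inj t_inj st; apply: mxeP => I J.
rewrite !mxe_loc_disjoint // => [|a b]; last by rewrite eq_sym.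
rewrite (mulrC (mxe M _ _)); congr (_%:R * _); congr nat_of_bool.
by apply: eq_forallb => j; rewrite andbC.
Qed.
End LocalOperators.

(** * The representation of the Hecke algebra on tensor powers *)

Section HeckeOperators.
Variables (K : fieldType) (q : K) (d : nat) (R : tensor4 K d).
Local Notation T n := (n.-tuple 'I_d).
Local Notation Mat n := 'M[K]_#|{: n.-tuple 'I_d}|.
Local Notation Rop := (Rop R).
Local Notation R2 := (Rop (n := 2) ord0).

Definition site n (i : 'I_n.-1) (a : 'I_2) : 'I_n :=
  if a == ord0 then site0 i else site1 i.

Lemma site_inj n (i : 'I_n.-1) : injective (site i).
Proof.
have ne0 (a : 'I_2) : a <> ord0 -> a = ord_max.
  by case: a => [[|[|m]] Hm] H; [case: H| |]; apply: val_inj.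
move=> a b; rewrite /site; case: eqP => [->|na]; case: eqP => [->|nb] //.
- by move/(congr1 val) => /= /n_Sn.
- by move/(congr1 val) => /= /esym/n_Sn.
by move=> _; rewrite (ne0 a) // (ne0 b).
Qed.

Lemma mem_site n (i : 'I_n.-1) j :
  (j \in codom (site i)) = (j == site0 i) || (j == site1 i).
Proof.
apply/codomP/orP => [[a ->]|[]/eqP->].
- by rewrite /site; case: ifP => _; rewrite eqxx; [left | right].
- by exists ord0.
by exists ord_max.
Qed.

Lemma mxe_Rop2 I J : mxe R2 I J =
  R (tnth I ord0) (tnth I ord_max) (tnth J ord0) (tnth J ord_max).
Proof.
rewrite mxe_multi big1 ?mulr1; last by case=> [[|[|m]] Hk] //= /andP[].
have -> : site0 (@ord0 0 : 'I_2.-1) = ord0 by apply: val_inj.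
by have -> : site1 (@ord0 0 : 'I_2.-1) = ord_max by apply: val_inj.
Qed.

(** Every R_i is the one operator R on two factors, moved to adjacent sites. Through [loc], the
    quadratic and braid relations then come from those on two and three factors. *)
Lemma RopE n (i : 'I_n.-1) : Rop i = loc (site i) R2.
Proof.
apply: mxeP => I J; rewrite mxe_loc mxe_multi mxe_Rop2 !tnth_sel /site /= mulrC.
congr (_ * _); have [/offP IJ|] := boolP (off (site i) I J).
  rewrite big1 // => k /andP[k0 k1]; rewrite IJ ?eqxx //.
  by rewrite mem_site negb_or k0.
rewrite negb_forall => /existsP[k]; rewrite negb_imply mem_site negb_or.
by case/andP=> k01 /negPf kIJ; rewrite (bigD1 k) //= kIJ mul0r.
Qed.

Lemma loc_Rop n k (s : 'I_k -> 'I_n) (i : 'I_k.-1) (j : 'I_n.-1) : injective s ->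
  s (site0 i) = site0 j -> s (site1 i) = site1 j -> loc s (Rop i) = Rop j.
Proof.
move=> s_inj s0 s1; rewrite (RopE i) (RopE j) loc_comp //; apply: eq_loc => a.
by rewrite /= /site; case: ifP.
Qed.

Section HeckeSymmetry.
Variables (P : tensor4 K d) (R_hecke : hecke_symmetry q R P).

Lemma Rop_quad n (i : 'I_n.-1) : Rop i *m Rop i = (q - 1) *: Rop i + q%:M.
Proof.
have R2q : R2 *m R2 = (q - 1) *: R2 + q%:M.
  have := hs_quadratic R_hecke => /=; rewrite mulmxBl !mulmxDr !mulmx1 mul_scalar_mx.
  move/eqP; rewrite subr_eq0 => /eqP/(canRL (addrK _)) ->.
  by rewrite scalerBl scale1r addrAC.
rewrite (RopE i) -locM ?R2q; last exact: site_inj.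
by rewrite locD locZ -scalemx1 locZ loc1 scalemx1.
Qed.

Lemma Rop_braid n (i j : 'I_n.-1) : j = i.+1 :> nat ->
  Rop i *m Rop j *m Rop i = Rop j *m Rop i *m Rop j.
Proof.
move=> ji; have i3 : (i + 3 <= n)%N by have := ltn_ord (site1 j); rewrite /= ji addn3.
(* The sites i, i + 1, i + 2, to which the braid relation on three factors is transported. *)
pose s (a : 'I_3) : 'I_n := widen_ord i3 (rshift i a).
have s_inj : injective s by move=> a b /(congr1 val)/= /addnI/val_inj.
have si : loc s (Rop (n := 3) ord0) = Rop i.
  by apply: loc_Rop => //; apply: val_inj; rewrite /= ?addn0 ?addn1.
have sj : loc s (Rop (n := 3) ord_max) = Rop j.
  by apply: loc_Rop => //; apply: val_inj; rewrite /= ?ji ?addn1 ?addn2.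
by rewrite -si -sj -!locM // (hs_braid R_hecke).
Qed.

Lemma Rop_comm n (i j : 'I_n.-1) : (i.+1 < j)%N -> Rop i *m Rop j = Rop j *m Rop i.
Proof.
move=> ij; rewrite (RopE i) (RopE j); apply: loc_commute; try exact: site_inj.
move=> a b; apply/eqP => /(congr1 val); rewrite /site.
case: ifP => _; case: ifP => _ /= H; move: ij; rewrite ltnNge => /negP[].
- by rewrite H leqnSn.
- by rewrite H !leqW.
- by rewrite H.
by case: H => ->; rewrite leqnSn.
Qed.

Local Notation rho := (rho (q := q) R).
Local Notation fR n := (fun w : seq 'I_n.-1 => \prod_(i <- w) Rop i).

Let rho_hyps n :
  [/\ forall v, linear (@mulmx K _ _ _ ^~ v : Mat n -> Mat n),
      forall u, linear (@mulmx K _ _ _ u : Mat n -> Mat n),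
      forall s t, fR n (s ++ t) = fR n s *m fR n t
    & forall s, hecke_rel q s -> word_ext (fR n) s = 0].
Proof.
have wg w : word_ext (fR n) (\prod_(i <- w) gen K i) = fR n w.
  exact: word_ext_word.
have wg1 i : word_ext (fR n) (gen K i) = Rop i.
  by have := wg [:: i]; rewrite !big_seq1.
split=> [v a u w|u a v w|s t|s].
- by rewrite mulmxDl scalemxAl.
- by rewrite mulmxDr scalemxAr.
- exact: big_cat.
case=> [i j ij|i j ij|i].
- have := wg [:: i; j; i]; have := wg [:: j; i; j].
  rewrite !big_cons !big_nil !mulr1 !mulrA => e1 e2.
  rewrite linearB /= e1 e2; apply/eqP; rewrite subr_eq0; apply/eqP.
  exact: Rop_braid.
- have := wg [:: i; j]; have := wg [:: j; i].
  rewrite !big_cons !big_nil !mulr1 => e1 e2.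
  rewrite linearB /= e1 e2; apply/eqP; rewrite subr_eq0; apply/eqP.
  exact: Rop_comm.
have := wg [:: i; i]; have := wg [::].
rewrite !big_cons !big_nil !mulr1 => e1 e2.
rewrite expr2 linearB linearD !linearZ /= e1 e2 wg1; apply/eqP.
by rewrite subr_eq0; apply/eqP; have := Rop_quad i; rewrite -scalemx1.
Qed.

Lemma rho_linear n : linear (@rho n).
Proof. by have [h1 h2 h3 h4] := rho_hyps n; apply: (presented_ext_linear h1 h2 h3 h4). Qed.

Lemma rhoM n (g h : hecke q n) : rho (g * h) = rho g *m rho h.
Proof. by have [h1 h2 h3 h4] := rho_hyps n; apply: (presented_extM h1 h2 h3 h4). Qed.

Lemma rho_word n (w : seq 'I_n.-1) :
  rho (\prod_(i <- w) hecke_gen q i) = \prod_(i <- w) Rop i.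
Proof. by have [h1 h2 h3 h4] := rho_hyps n; apply: (presented_ext_word h1 h2 h3 h4). Qed.

Lemma rho1 n : rho (1 : hecke q n) = 1%:M.
Proof. by have := rho_word [::] (n := n); rewrite !big_nil. Qed.

Lemma rho_gen n (i : 'I_n.-1) : rho (hecke_gen q i) = Rop i.
Proof. by have := rho_word [:: i]; rewrite !big_seq1. Qed.

Lemma rho_rep n : is_rep (@rho n).
Proof. by split; [apply: rho_linear | apply: rho1 | apply: rhoM]. Qed.
End HeckeSymmetry.
End HeckeOperators.

Lemma sum_pair_tuple (V : nmodType) (X : finType) (f : 2.-tuple X -> V) :
  \sum_L f L = \sum_a \sum_b f [tuple a; b].
Proof.
rewrite pair_big (reindex (fun p : X * X => [tuple p.1; p.2])) //=.
exists (fun L : 2.-tuple X => (tnth L ord0, tnth L ord_max)) => [[a b] _ //|L _].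
apply: eq_from_tnth => -[[|[|m]] Hm] //; rewrite (tnth_nth (tnth L ord0)) /=.
  by congr tnth; apply: val_inj.
by congr tnth; apply: val_inj.
Qed.

(** The order of the factors matters in [A]. The outer parts are functionals of the family, so that
    two families agreeing off the sites share them. *)
Lemma prod_site_split (A : pzSemiRingType) n (i : 'I_n.-1) :
  exists pre post : ('I_n -> A) -> A,
    (forall f, \prod_k f k = pre f * (f (site0 i) * f (site1 i)) * post f) /\
    forall f g, (forall k, k \notin codom (site i) -> f k = g k) ->
      pre f = pre g /\ post f = post g.
Proof.
(* Padding with 1 lets the product be cut at natural number bounds. *)
pose F (f : 'I_n -> A) (k : nat) : A := oapp f 1 (insub k).
have FE f (k : 'I_n) : F f k = f k by rewrite /F valK.
exists (fun f => \prod_(0 <= k < i) F f k), (fun f => \prod_(i.+2 <= k < n) F f k).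
have i2n : (i.+2 <= n)%N by exact: ltn_ord (site1 i).
split=> [f|f g fg].
  under eq_bigr => k _ do rewrite -FE.
  rewrite -(big_mkord xpredT (F f)) (@big_cat_nat _ _ _ i.+2) //=; congr (_ * _).
  rewrite !big_nat_recr //= -mulrA; congr (_ * (_ * _)); [exact: (FE f (site0 i))|].
  exact: (FE f (site1 i)).
split; apply: eq_big_nat => k /andP[k1 k2].
  have kn : (k < n)%N by apply: leq_trans k2 (leq_trans (leqnSn _) (leq_trans (leqnSn _) _)).
  rewrite -[k]/(val (Ordinal kn)) !FE fg // mem_site -!val_eqE /= negb_or.
  by rewrite !neq_ltn k2 ltnS (ltnW k2).
rewrite -[k]/(val (Ordinal k2)) !FE fg // mem_site -!val_eqE /= negb_or.
by rewrite !neq_ltn k1 (ltnW k1) !orbT.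
Qed.

(** * Tensor powers of a matrix W with R W_1 W_2 = W_1 W_2 R *)

Section PowerCommute.
Variables (K : fieldType) (d : nat) (R : tensor4 K d) (A : algType K).
Variable w : 'I_d -> 'I_d -> A.
Hypothesis wR : forall i j k l, \sum_m \sum_n R i j m n *: (w m k * w n l) =
  \sum_p \sum_s R p s k l *: (w i p * w j s).
Local Notation T n := (n.-tuple 'I_d).

Definition wpow n (I J : T n) : A := \prod_(k < n) w (tnth I k) (tnth J k).

(** The factors off the sites of R_i are common to all terms of both sums; what remains between them
    is [wR]. This serves both for D over K and for the generators z over H_R. *)
Lemma wpow_Rop n (i : 'I_n.-1) (I J : T n) :
  \sum_L mxe (Rop R i) I L *: wpow L J = \sum_L mxe (Rop R i) L J *: wpow I L.
Proof.
have s_inj := @site_inj n i; have [pre [post [prodE ext]]] := prod_site_split A i.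
rewrite (RopE R i) sum_locl // sum_locr //.
pose f (L M : T n) k := w (tnth L k) (tnth M k).
have e0 L M : wpow L M = pre (f L M) * (f L M (site0 i) * f L M (site1 i)) * post (f L M).
  exact: prodE.
have preL (L : T 2) : pre (f (put (site i) I L) J) = pre (f I J) /\
                      post (f (put (site i) I L) J) = post (f I J).
  by apply: ext => k ki; rewrite /f put_out.
have preR (L : T 2) : pre (f I (put (site i) J L)) = pre (f I J) /\
                      post (f I (put (site i) J L)) = post (f I J).
  by apply: ext => k ki; rewrite /f put_out.
have put0 I' (L : T 2) : tnth (put (site i) I' L) (site0 i) = tnth L ord0.
  exact: (put_in s_inj I' L ord0).
have put1 I' (L : T 2) : tnth (put (site i) I' L) (site1 i) = tnth L ord_max.
  exact: (put_in s_inj I' L ord_max).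
under eq_bigr => L _ do
  rewrite e0 (preL L).1 (preL L).2 /f !put0 !put1 scalerAl scalerAr mxe_Rop2 !tnth_sel.
under [RHS]eq_bigr => L _ do
  rewrite e0 (preR L).1 (preR L).2 /f !put0 !put1 scalerAl scalerAr mxe_Rop2 !tnth_sel.
rewrite -!mulr_suml -!mulr_sumr !sum_pair_tuple; congr (_ * _ * _).
exact: wR.
Qed.
End PowerCommute.

(** * The matrix D *)

Section QuantumTrace.
Variables (K : fieldType) (q : K) (q_neq0 : q != 0) (d : nat).
Local Notation T n := (n.-tuple 'I_d).

Let delta (i j : 'I_d) : K := (i == j)%:R.

Let sum_deltal (F : 'I_d -> K) k : \sum_m delta m k * F m = F k.
Proof.
rewrite (bigD1 k) //= /delta eqxx mul1r big1 ?addr0 // => m /negPf->.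
by rewrite mul0r.
Qed.

Let sum_deltar (F : 'I_d -> K) k : \sum_m delta k m * F m = F k.
Proof. by rewrite -(sum_deltal F k); apply: eq_bigr => m _; rewrite /delta eq_sym. Qed.

Lemma mxe_Rop3_0 (R : tensor4 K d) (M : 'M[K]_#|{: T 3}|) a b c J :
  mxe (Rop R (n := 3) ord0 *m M) [tuple a; b; c] J =
  \sum_u \sum_v R a b u v * mxe M [tuple u; v; c] J.
Proof.
have s_inj := @site_inj 3 ord0.
rewrite mxeM (RopE R (n := 3)).
rewrite (sum_locl (V := K^o) _ _ (fun L => mxe M L J)) // sum_pair_tuple.
apply: eq_bigr => u _; apply: eq_bigr => v _; rewrite mxe_Rop2 !tnth_sel.
congr (_ * mxe M _ J); apply: eq_from_tnth => -[[|[|[|m]]] Hm] //.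
- by rewrite (_ : Ordinal Hm = @site 3 ord0 ord0) ?put_in //; apply: val_inj.
- by rewrite (_ : Ordinal Hm = @site 3 ord0 ord_max) ?put_in //; apply: val_inj.
by rewrite put_out // mem_site.
Qed.

Lemma mxe_Rop3_1 (R : tensor4 K d) (M : 'M[K]_#|{: T 3}|) a b c J :
  mxe (Rop R (n := 3) ord_max *m M) [tuple a; b; c] J =
  \sum_u \sum_v R b c u v * mxe M [tuple a; u; v] J.
Proof.
have s_inj := @site_inj 3 ord_max.
rewrite mxeM (RopE R (n := 3)).
rewrite (sum_locl (V := K^o) _ _ (fun L => mxe M L J)) // sum_pair_tuple.
apply: eq_bigr => u _; apply: eq_bigr => v _; rewrite mxe_Rop2 !tnth_sel.
congr (_ * mxe M _ J); apply: eq_from_tnth => -[[|[|[|m]]] Hm] //.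
- by rewrite put_out // mem_site.
- by rewrite (_ : Ordinal Hm = @site 3 ord_max ord0) ?put_in //; apply: val_inj.
by rewrite (_ : Ordinal Hm = @site 3 ord_max ord_max) ?put_in //; apply: val_inj.
Qed.

Lemma mxe_Rop3_0E (R : tensor4 K d) a b c x y z :
  mxe (Rop R (n := 3) ord0) [tuple a; b; c] [tuple x; y; z] = R a b x y * delta c z.
Proof.
have s_inj := @site_inj 3 ord0.
rewrite -[Rop R _]mulmx1 mxe_Rop3_0 (bigD1 x) //= [X in _ + X]big1 ?addr0; last first.
  move=> u nux; apply: big1 => v _; rewrite mxe1 -val_eqE /= !eqseq_cons (negPf nux).
  by rewrite mulr0.
rewrite (bigD1 y) //= [X in _ + X]big1 ?addr0; last first.
  move=> v nvy; rewrite mxe1 -val_eqE /= !eqseq_cons (negPf nvy) andbF.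
  by rewrite mulr0.
by rewrite mxe1 -val_eqE /= !eqseq_cons !eqxx andbT.
Qed.

Lemma mxe_Rop3_1E (R : tensor4 K d) a b c x y z :
  mxe (Rop R (n := 3) ord_max) [tuple a; b; c] [tuple x; y; z] = delta a x * R b c y z.
Proof.
rewrite -[Rop R _]mulmx1 mxe_Rop3_1 (bigD1 y) //= [X in _ + X]big1 ?addr0; last first.
  move=> u nuy; apply: big1 => v _; rewrite mxe1 -val_eqE /= !eqseq_cons (negPf nuy) andbF.
  by rewrite mulr0.
rewrite (bigD1 z) //= [X in _ + X]big1 ?addr0; last first.
  move=> v nvz; rewrite mxe1 -val_eqE /= !eqseq_cons (negPf nvz) !andbF.
  by rewrite mulr0.
by rewrite mxe1 -val_eqE /= !eqseq_cons !eqxx !andbT mulrC.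
Qed.

(** The three tensors are independent so that an outer one can later be the inverse of the Hecke
    symmetry. *)
Lemma mxe_Rop3_010 (R S Q : tensor4 K d) a b c x y z :
  mxe (Rop R (n := 3) ord0 *m Rop S (n := 3) ord_max *m Rop Q (n := 3) ord0)
      [tuple a; b; c] [tuple x; y; z] =
  \sum_v \sum_w (\sum_u R a b u v * Q u w x y) * S v c w z.
Proof.
rewrite -mulmxA mxe_Rop3_0 exchange_big; apply: eq_bigr => v _ /=.
under [RHS]eq_bigr => w _ do rewrite mulr_suml.
rewrite [RHS]exchange_big; apply: eq_bigr => u _ /=.
rewrite mxe_Rop3_1 mulr_sumr; apply: eq_bigr => w _.
under eq_bigr => t _ do rewrite mxe_Rop3_0E.
rewrite (bigD1 z) //= big1 ?addr0 => [|t /negPf tz]; last first.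
  by rewrite /delta tz !mulr0.
by rewrite /delta eqxx mulr1 -!mulrA (mulrC (S _ _ _ _)).
Qed.

Lemma mxe_Rop3_101 (R S Q : tensor4 K d) a b c x y z :
  mxe (Rop R (n := 3) ord_max *m Rop S (n := 3) ord0 *m Rop Q (n := 3) ord_max)
      [tuple a; b; c] [tuple x; y; z] =
  \sum_u \sum_v \sum_w R b c u v * S a u x w * Q w v y z.
Proof.
rewrite -mulmxA mxe_Rop3_1; apply: eq_bigr => u _; apply: eq_bigr => v _.
rewrite mxe_Rop3_0 mulr_sumr (bigD1 x) //= [X in _ + X]big1 ?addr0; last first.
  move=> t /negPf tx; apply/eqP; rewrite mulf_eq0 big1 ?eqxx ?orbT // => w _.
  by rewrite mxe_Rop3_1E /delta tx mul0r mulr0.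
rewrite mulr_sumr; apply: eq_bigr => w _.
by rewrite mxe_Rop3_1E /delta eqxx mul1r mulrA.
Qed.

Variables (R P : tensor4 K d) (R_hecke : hecke_symmetry q R P).
Local Notation D := (Dmx P).

(** The inverse of R: the quadratic relation reads R (R - (q - 1)) = q. *)
Let S : tensor4 K d := fun i j k l => q^-1 * (R i j k l - (q - 1) * (delta i k * delta j l)).

Let R2S : Rop S (n := 2) ord0 = q^-1 *: (Rop R (n := 2) ord0 - (q - 1)%:M).
Proof.
apply: mxeP => I J; rewrite -scalemx1 !(mxeZ, mxeB, mxe_Rop2, mxe1) /S.
congr (_ * (_ - _ * _)); rewrite -natrM mulnb; congr (nat_of_bool _)%:R.
apply/andP/eqP => [[/eqP e0 /eqP e1]|->]; last by rewrite !eqxx.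
apply: eq_from_tnth => -[[|[|m]] Hm] //.
  by rewrite (_ : Ordinal Hm = ord0) //; apply: val_inj.
by rewrite (_ : Ordinal Hm = ord_max) //; apply: val_inj.
Qed.

Let RopS n (i : 'I_n.-1) : Rop S i = q^-1 *: (Rop R i - (q - 1)%:M).
Proof.
rewrite (RopE S i) R2S locZ (RopE R i) -scaleN1r locD !locZ -scalemx1 locZ loc1.
by rewrite scaleN1r scalemx1.
Qed.

Let SR b c y z : \sum_u \sum_v S b c u v * R u v y z = delta b y * delta c z.
Proof.
have : Rop S (n := 2) ord0 *m Rop R (n := 2) ord0 = 1%:M.
  rewrite RopS -scalemxAl mulmxBl (Rop_quad R_hecke) mul_scalar_mx addrC addrA addNr add0r.
  by rewrite scale_scalar_mx mulVf.
move/(congr1 (fun M => mxe M [tuple b; c] [tuple y; z])).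
rewrite mxeM sum_pair_tuple mxe1 -val_eqE /= !eqseq_cons andbT -mulnb natrM.
by move=> <-; apply: eq_bigr => u _; apply: eq_bigr => v _; rewrite !mxe_Rop2.
Qed.

Let RS b c y z : \sum_u \sum_v R b c u v * S u v y z = delta b y * delta c z.
Proof.
have : Rop R (n := 2) ord0 *m Rop S (n := 2) ord0 = 1%:M.
  rewrite RopS -scalemxAr mulmxBr (Rop_quad R_hecke) mul_mx_scalar addrC addrA addNr add0r.
  by rewrite scale_scalar_mx mulVf.
move/(congr1 (fun M => mxe M [tuple b; c] [tuple y; z])).
rewrite mxeM sum_pair_tuple mxe1 -val_eqE /= !eqseq_cons andbT -mulnb natrM.
by move=> <-; apply: eq_bigr => u _; apply: eq_bigr => v _; rewrite !mxe_Rop2.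
Qed.

(** R_1 R_2 S_1 = S_2 R_1 R_2: as S is affine in R, both sides are q^-1 times the braid product
    minus (q - 1) R_1 R_2. *)
Let braid_RRS a b c x y z :
  \sum_v \sum_w (\sum_u R a b u v * S u w x y) * R v c w z =
  \sum_u \sum_v \sum_w S b c u v * R a u x w * R w v y z.
Proof.
rewrite -mxe_Rop3_010 -mxe_Rop3_101 !RopS; congr (mxe _ _ _).
rewrite -!scalemxAl -scalemxAr mulmxBr !mulmxBl mul_mx_scalar !mul_scalar_mx -scalemxAl.
by rewrite (hs_braid R_hecke).
Qed.

(** S_1 R_2 R_1 = R_2 R_1 S_2, by the same computation with R_2 R_1. *)
Let braid_SRR a b c x y z :
  \sum_v \sum_w (\sum_u S a b u v * R u w x y) * R v c w z =
  \sum_u \sum_v \sum_w R b c u v * R a u x w * S w v y z.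
Proof.
rewrite -mxe_Rop3_010 -mxe_Rop3_101 !RopS; congr (mxe _ _ _).
rewrite -!scalemxAl -scalemxAr mulmxBr !mulmxBl mul_mx_scalar !mul_scalar_mx -scalemxAl.
by rewrite (hs_braid R_hecke).
Qed.

(** With the indices regrouped in pairs, [hs_closed] says that the square matrices of P and R have
    product 1; hence so does the product in the other order. *)
Let skew_inv s p p' s' :
  \sum_k \sum_l R s k p l * P l p' k s' = delta p p' * delta s s'.
Proof.
pose M1 : 'M[K]_#|{: 'I_d * 'I_d}| :=
  \matrix_(a, b) P (enum_val a).1 (enum_val b).1 (enum_val a).2 (enum_val b).2.
pose M2 : 'M[K]_#|{: 'I_d * 'I_d}| :=
  \matrix_(a, b) R (enum_val a).2 (enum_val b).2 (enum_val a).1 (enum_val b).1.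
have sumE (f : 'I_#|{: 'I_d * 'I_d}| -> K) :
    \sum_a f a = \sum_i \sum_j f (enum_rank (i, j)).
  rewrite pair_big (reindex (@enum_rank {: 'I_d * 'I_d})) /=.
    by apply: eq_bigr => -[].
  by exists enum_val => x _; [apply: enum_rankK | apply: enum_valK].
have : M1 *m M2 = 1%:M.
  apply/matrixP => a b; rewrite !mxE sumE.
  under eq_bigr => i _ do under eq_bigr => j _ do rewrite !mxE !enum_rankK /=.
  rewrite (hs_closed R_hecke) -natrM mulnb; congr (nat_of_bool _)%:R.
  by rewrite -(inj_eq enum_val_inj) -pair_eqE /= (eq_sym (enum_val b).2).
move/mulmx1C/(congr1 (fun M : 'M__ => M (enum_rank (p, s)) (enum_rank (p', s')))).
rewrite !mxE sumE (inj_eq enum_rank_inj) -pair_eqE /= -mulnb natrM exchange_big /=.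
by move=> <-; apply: eq_bigr => i _; apply: eq_bigr => j _; rewrite !mxE !enum_rankK.
Qed.

(* Contracting with P removes a factor R. *)
Let strip G H :
    (forall c z, \sum_v \sum_w G v w * R v c w z = H c z) ->
  forall v w, G v w = \sum_c \sum_z H c z * P z w c v.
Proof.
move=> GH v w; transitivity (\sum_v' \sum_w' G v' w' *
    \sum_c \sum_z R v' c w' z * P z w c v).
  under eq_bigr => v' _ do under eq_bigr => w' _ do
    rewrite skew_inv mulrC -mulrA mulrCA.
  under eq_bigr => v' _ do rewrite -mulr_sumr.
  by rewrite !sum_deltal.
under [RHS]eq_bigr => c _ do under eq_bigr => z _ do
  rewrite -GH mulr_suml.
under [RHS]eq_bigr => c _ do rewrite exchange_big /=.
rewrite [RHS]exchange_big /=; apply: eq_bigr => v' _.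
under [RHS]eq_bigr => c _ do under eq_bigr => z _ do rewrite mulr_suml.
under [RHS]eq_bigr => c _ do rewrite exchange_big /=.
rewrite [RHS]exchange_big /=; apply: eq_bigr => w' _.
rewrite mulr_sumr; apply: eq_bigr => c _; rewrite mulr_sumr.
by apply: eq_bigr => z _; rewrite mulrA.
Qed.

(** Tr_1 (D_1 R_12) = 1, obtained by setting i = j in [hs_closed] and summing. *)
Let trace_R k l : \sum_p \sum_s D p s * R s k p l = delta k l.
Proof.
under eq_bigr => p _ do under eq_bigr => s _ do rewrite mulr_suml.
under eq_bigr => p _ do rewrite exchange_big.
rewrite exchange_big /=; under eq_bigr => i _ do rewrite (hs_closed R_hecke).
by rewrite -(sum_deltar (fun i => delta i l) k); apply: eq_bigr => i _; rewrite mulrC.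
Qed.

(* Tr_1 (D_1 X1_12 R_23 X2_12) = Tr_1 (D_1 Y1_23 R_12 Y2_23) = 1, after which
   R_23 is removed; D_S and S_D remove R_12 in turn. *)
Let trace_braid (X1 X2 Y1 Y2 : tensor4 K d) :
    (forall a b c x y z,
      \sum_v \sum_w (\sum_u X1 a b u v * X2 u w x y) * R v c w z =
      \sum_u \sum_v \sum_w Y1 b c u v * R a u x w * Y2 w v y z) ->
    (forall b c y z, \sum_u \sum_v Y1 b c u v * Y2 u v y z = delta b y * delta c z) ->
  forall b v w y, \sum_x \sum_a D x a * (\sum_u X1 a b u v * X2 u w x y) =
    delta b y * D w v.
Proof.
move=> braid Y12 b v w y.
pose G v w := \sum_x \sum_a D x a * (\sum_u X1 a b u v * X2 u w x y).
rewrite -/(G v w) (@strip G (fun c z => delta b y * delta c z)).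
  rewrite /Dmx mulr_sumr; apply: eq_bigr => c _.
  under eq_bigr => z _ do rewrite -mulrA.
  by rewrite -mulr_sumr sum_deltar.
move=> c z; rewrite -Y12.
transitivity (\sum_x \sum_a D x a *
    (\sum_v \sum_w (\sum_u X1 a b u v * X2 u w x y) * R v c w z)).
  under eq_bigr => v' _ do under eq_bigr => w' _ do rewrite mulr_suml.
  under eq_bigr => v' _ do rewrite exchange_big /=.
  rewrite exchange_big /=; apply: eq_bigr => x _.
  under eq_bigr => v' _ do under eq_bigr => w' _ do rewrite mulr_suml.
  under eq_bigr => v' _ do rewrite exchange_big /=.
  rewrite exchange_big /=; apply: eq_bigr => a _.
  rewrite mulr_sumr; apply: eq_bigr => v' _.
  by rewrite mulr_sumr; apply: eq_bigr => w' _; rewrite mulrA.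
under eq_bigr => x _ do under eq_bigr => a _ do rewrite braid mulr_sumr.
under eq_bigr => x _ do rewrite exchange_big /=.
rewrite exchange_big /=; apply: eq_bigr => u _.
under eq_bigr => x _ do under eq_bigr => a _ do rewrite mulr_sumr.
under eq_bigr => x _ do rewrite exchange_big /=.
rewrite exchange_big /=; apply: eq_bigr => v' _.
under eq_bigr => x _ do under eq_bigr => a _ do rewrite mulr_sumr.
under eq_bigr => x _ do rewrite exchange_big /=.
rewrite exchange_big /=.
(* [Y1] and [Y2] act on factors 2 and 3, so the trace over factor 1 sees only R_12, and [trace_R]
   collapses it. *)
transitivity (\sum_w' delta u w' * (Y1 b c u v' * Y2 w' v' y z)).
  apply: eq_bigr => w' _; rewrite -trace_R mulr_suml; apply: eq_bigr => x _.
  rewrite mulr_suml; apply: eq_bigr => a _.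
  by rewrite -!mulrA; congr (_ * _); rewrite mulrCA.
exact: sum_deltar.
Qed.

(* D_1 P_12 = S_21 D_2 *)
Let D_S s p y t : \sum_x D x t * S s p x y = \sum_k D p k * P k s y t.
Proof.
pose G a u := \sum_x D x a * S u p x y.
rewrite -/(G t s) (@strip G (fun b v => delta b y * D p v)).
  under eq_bigr => c _ do under eq_bigr => z _ do rewrite -mulrA.
  under eq_bigr => c _ do rewrite -mulr_sumr.
  by rewrite sum_deltal.
move=> b v; rewrite -(trace_braid braid_RRS SR) exchange_big /=.
under [RHS]eq_bigr => x _ do under eq_bigr => a _ do rewrite mulr_sumr.
under [RHS]eq_bigr => x _ do rewrite exchange_big /=.
rewrite [RHS]exchange_big /=; apply: eq_bigr => u _.
rewrite [RHS]exchange_big /=; apply: eq_bigr => a _.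
by rewrite mulr_suml; apply: eq_bigr => x _; rewrite -mulrA (mulrC (S _ _ _ _)).
Qed.

(* P_12 D_1 = D_2 S_21 *)
Let S_D s b t k : \sum_a D s a * S a b t k = \sum_p D p k * P b s p t.
Proof.
pose G u x := \sum_a D x a * S a b u k.
rewrite -/(G t s) (@strip G (fun w y => delta b y * D w k)).
  apply: eq_bigr => w _.
  under eq_bigr => z _ do rewrite -mulrA.
  by rewrite sum_deltar.
move=> w y; rewrite -(trace_braid braid_SRR RS).
under [RHS]eq_bigr => x _ do under eq_bigr => a _ do rewrite mulr_sumr.
under [RHS]eq_bigr => x _ do rewrite exchange_big /=.
rewrite [RHS]exchange_big /=; apply: eq_bigr => u _; apply: eq_bigr => x _.
by rewrite mulr_suml; apply: eq_bigr => a _; rewrite mulrA.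
Qed.

(** Both sides equal one contraction of P with two copies of D: [D_S] rewrites the left one and
    [S_D] the right one. *)
Let S_DD s p t k :
  \sum_x \sum_y S s p x y * (D x t * D y k) = \sum_a \sum_b S a b t k * (D s a * D p b).
Proof.
transitivity (\sum_y (\sum_x D x t * S s p x y) * D y k).
  rewrite exchange_big; apply: eq_bigr => y _; rewrite mulr_suml.
  by apply: eq_bigr => x _; rewrite mulrA (mulrC (D x t)).
under eq_bigr => y _ do rewrite D_S.
transitivity (\sum_b (\sum_a D s a * S a b t k) * D p b); last first.
  rewrite exchange_big; apply: eq_bigr => b _; rewrite mulr_suml.
  by apply: eq_bigr => a _; rewrite mulrA (mulrC (D s a)).
under [RHS]eq_bigr => b _ do rewrite S_D mulr_suml.
under eq_bigr => y _ do rewrite mulr_suml.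
rewrite exchange_big /=; apply: eq_bigr => b _; apply: eq_bigr => y _.
by rewrite mulrC mulrA mulrAC.
Qed.

(** Since R = q S + (q - 1), commutation of D (x) D with S passes to R. *)
Lemma Dmx_R i j k l : \sum_m \sum_n R i j m n * (D m k * D n l) =
  \sum_p \sum_s R p s k l * (D i p * D j s).
Proof.
have [S' RE S'_DD] : exists2 S' : tensor4 K d,
    forall a b x y, R a b x y = q * S' a b x y + (q - 1) * (delta a x * delta b y) &
    forall s p t k, \sum_x \sum_y S' s p x y * (D x t * D y k) =
                    \sum_a \sum_b S' a b t k * (D s a * D p b).
  by exists S => [a b x y|]; [rewrite /S mulVKf // subrK | exact: S_DD].
under eq_bigr => m _ do under eq_bigr => n _ do rewrite RE mulrDl -!mulrA.
under eq_bigr => m _ do rewrite big_split /= -!mulr_sumr sum_deltar.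
rewrite big_split /= -!mulr_sumr sum_deltar S'_DD.
under [RHS]eq_bigr => m _ do under eq_bigr => n _ do rewrite RE mulrDl -!mulrA.
under [RHS]eq_bigr => m _ do rewrite big_split /= -!mulr_sumr sum_deltal.
by rewrite big_split /= -!mulr_sumr sum_deltal.
Qed.
End QuantumTrace.

(** * The map Phi *)

Lemma sum_aq (K : fieldType) (A : algType K) (S : A -> Prop) I (s : seq I) F :
  aq S (\sum_(i <- s) F i) = \sum_(i <- s) aq S (F i).
Proof. exact: (big_morph _ (aqD S) (erefl _)). Qed.

Lemma aq_rel (K : fieldType) (A : algType K) (S : A -> Prop) x y :
  S (x - y) -> aq S x = aq S y.
Proof.
move=> Sxy; apply/aq_eqP; rewrite -[x - y]addr0 -[x - y]mul1r -[1 * _]mulr1.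
by apply: ideal_genD => //; apply: ideal_gen0.
Qed.

Section Commutation.
Variables (K : fieldType) (q : K) (d : nat) (R P : tensor4 K d).
Hypothesis R_hecke : hecke_symmetry q R P.
Local Notation T n := (n.-tuple 'I_d).
Local Notation rho := (rho (q := q) R).

Lemma commute_rho n (B : 'M[K]_#|{: T n}|) :
  (forall i, Rop R i *m B = B *m Rop R i) -> forall h, rho h *m B = B *m rho h.
Proof.
move=> RB; elim/presented_ind => [|a u v IHu IHv|i u IHu].
- by rewrite (rho1 R_hecke) mul1mx mulmx1.
- by rewrite (rho_linear R_hecke) mulmxDl mulmxDr -scalemxAl -scalemxAr IHu IHv.
rewrite (rhoM R_hecke) (rho_gen R_hecke) -mulmxA IHu.
by rewrite !mulmxA RB.
Qed.

(** The analogue of [commute_rho] for a matrix [W] with entries in a K-module; the induction works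
    because the left and right actions of scalar matrices commute. *)
Lemma rho_commutation n (V : lmodType K) (W : T n -> T n -> V) :
    (forall i I J, \sum_L mxe (Rop R i) I L *: W L J = \sum_L mxe (Rop R i) L J *: W I L) ->
  forall (h : hecke q n) I J,
    \sum_L mxe (rho h) I L *: W L J = \sum_L mxe (rho h) L J *: W I L.
Proof.
move=> WR h I J.
elim/presented_ind: h I J => [|a u v IHu IHv|i u IHu] I J.
- rewrite (rho1 R_hecke) (bigD1 I) //= mxe1 eqxx scale1r big1 ?addr0 => [|L /negPf nL].
    rewrite (bigD1 J) //= mxe1 eqxx scale1r big1 ?addr0 // => L /negPf nL.
    by rewrite mxe1 nL scale0r.
  by rewrite mxe1 eq_sym nL scale0r.
- rewrite (rho_linear R_hecke).
  have lin (f g : T n -> T n * T n) : \sum_L mxe (a *: rho u + rho v) (f L).1 (f L).2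
      *: W (g L).1 (g L).2 = a *: (\sum_L mxe (rho u) (f L).1 (f L).2 *: W (g L).1 (g L).2)
      + \sum_L mxe (rho v) (f L).1 (f L).2 *: W (g L).1 (g L).2.
    under eq_bigr => L _ do rewrite mxeD mxeZ scalerDl -scalerA.
    by rewrite big_split -scaler_sumr.
  rewrite (lin (fun L => (I, L)) (fun L => (L, J))) /= IHu IHv.
  by rewrite (lin (fun L => (L, J)) (fun L => (I, L))).
rewrite (rhoM R_hecke) (rho_gen R_hecke).
transitivity (\sum_M mxe (Rop R i) I M *: \sum_L mxe (rho u) M L *: W L J).
  under eq_bigr => L _ do rewrite mxeM scaler_suml.
  rewrite exchange_big; apply: eq_bigr => M _ /=; rewrite scaler_sumr.
  by apply: eq_bigr => L _; rewrite scalerA.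
under eq_bigr => M _ do rewrite IHu scaler_sumr.
rewrite exchange_big /=.
transitivity (\sum_L mxe (rho u) L J *: \sum_M mxe (Rop R i) M L *: W I M).
  apply: eq_bigr => L _; rewrite -WR scaler_sumr.
  by apply: eq_bigr => M _; rewrite !scalerA mulrC.
under [LHS]eq_bigr => L _ do rewrite scaler_sumr.
rewrite exchange_big; apply: eq_bigr => M _ /=; rewrite mxeM scaler_suml.
by apply: eq_bigr => L _; rewrite scalerA mulrC.
Qed.
Hypothesis q_neq0 : q != 0.

Lemma mxe_Dpow n (I J : T n) : mxe (Dpow P n) I J = wpow (A := K^o) (Dmx P) I J.
Proof. exact: mxe_multi. Qed.

Lemma Dpow_rho n (h : hecke q n) : rho h *m Dpow P n = Dpow P n *m rho h.
Proof.
apply: mxeP => I J; rewrite !mxeM.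
under eq_bigr => L _ do rewrite mxe_Dpow.
have WR := wpow_Rop (A := K^o) (w := Dmx P) (Dmx_R q_neq0 R_hecke) (n := n).
rewrite [LHS](rho_commutation (V := K^o) WR).
by apply: eq_bigr => L _; rewrite mxe_Dpow [LHS]mulrC.
Qed.

Lemma Hz_RZZ i j k l : \sum_m \sum_n R i j m n *: (Hz R m k * Hz R n l) =
  \sum_p \sum_s R p s k l *: (Hz R i p * Hz R j s).
Proof.
have /aq_rel := frt_inv_RZZ (fun i j => gen K (inr (i, j)))
  (frt_RZZ R (fun i j => gen K (inl (i, j))) i j k l).
rewrite !sum_aq => E; transitivity (\sum_m aq (H_rel R) (\sum_n
    R i j m n *: (gen K (inl (m, k)) * gen K (inl (n, l))))).
  by apply: eq_bigr => m _; rewrite sum_aq; apply: eq_bigr => n _; rewrite aqZ aqM.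
rewrite E; apply: eq_bigr => m _; rewrite sum_aq.
by apply: eq_bigr => n _; rewrite aqZ aqM.
Qed.

Local Notation zpow := (wpow (A := H_alg R) (Hz R)).

Lemma zpow_Rop n (i : 'I_n.-1) (I J : T n) :
  \sum_L mxe (Rop R i) I L *: zpow L J = \sum_L mxe (Rop R i) L J *: zpow I L.
Proof. exact: (wpow_Rop (A := H_alg R) (w := Hz R) Hz_RZZ). Qed.

Variables (qh : K) (r : nat).
Local Notation Phi := (Phi R P qh r).

Lemma PhiE n (F : 'M[K]_#|{: T n}|) : Phi F =
  qh ^+ (n * r.+1) *: \sum_I \sum_J mxe (Dpow P n *m F) I J *: zpow J I.
Proof.
rewrite /Defs.Phi mxtrace_mxe; congr (_ *: _); apply: eq_bigr => I _.
rewrite mxeM; apply: eq_bigr => J _; rewrite {1}/mxe mxE mxe_multi.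
by rewrite mulr_algl.
Qed.

Lemma Phi_linear n : linear (@Defs.Phi K d R P qh r n).
Proof.
move=> a F G; rewrite !PhiE mulmxDr -scalemxAr scalerA mulrC -scalerA -scalerDr.
congr (_ *: _); rewrite scaler_sumr -big_split; apply: eq_bigr => I _ /=.
rewrite scaler_sumr -big_split; apply: eq_bigr => J _ /=.
by rewrite mxeD mxeZ scalerDl scalerA.
Qed.

Lemma Phi_trace n (g h : hecke q n) : Phi (rho (g * h)) = Phi (rho (h * g)).
Proof.
rewrite !PhiE !(rhoM R_hecke) !mulmxA -(Dpow_rho h) -!mulmxA; congr (_ *: _).
set X := Dpow P n *m rho g.
transitivity (\sum_I \sum_L mxe X I L *: \sum_J mxe (rho h) L J *: zpow J I).
  apply: eq_bigr => I _.
  under eq_bigr => J _ do rewrite mulmxA mxeM scaler_suml.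
  rewrite exchange_big; apply: eq_bigr => L _ /=; rewrite scaler_sumr.
  by apply: eq_bigr => J _; rewrite scalerA.
under eq_bigr => I _ do under eq_bigr => L _ do
  rewrite (rho_commutation (@zpow_Rop n)) scaler_sumr.
under eq_bigr => I _ do rewrite exchange_big /=.
rewrite exchange_big /=; apply: eq_bigr => J _.
rewrite exchange_big /=; apply: eq_bigr => L _.
rewrite -/X mxeM scaler_suml; apply: eq_bigr => I _.
by rewrite scalerA mulrC.
Qed.

(* Z^{(x) n} lies in the commutant of the R_i tensored with H_R. *)
Lemma zpow_param n : exists B : T n * T n -> 'M[K]_#|{: T n}|,
  (forall a i, Rop R i *m B a = B a *m Rop R i) /\
  forall I J, zpow I J = \sum_a mxe (B a) I J *: zpow a.1 a.2.
Proof.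
(* The index [j] is a position (row, column) of an unknown matrix W, and [l] = (i, (I, J)) stands
   for the (I, J) entry of the equation R_i W - W R_i = 0. *)
pose A (j : T n * T n) (l : 'I_n.-1 * (T n * T n)) : K :=
  mxe (Rop R l.1) l.2.1 j.1 * (j.2 == l.2.2)%:R -
  (j.1 == l.2.1)%:R * mxe (Rop R l.1) j.2 l.2.2.
have sumA (V : lmodType K) (f : T n * T n -> V) i I J :
    \sum_j A j (i, (I, J)) *: f j = \sum_L mxe (Rop R i) I L *: f (L, J)
      - \sum_L mxe (Rop R i) L J *: f (I, L).
  under eq_bigr => j _ do rewrite scalerBl.
  rewrite sumrB; congr (_ - _).
    transitivity (\sum_x \sum_y (mxe (Rop R i) I x * (y == J)%:R) *: f (x, y)).
      by rewrite pair_big /=; apply: eq_bigr => -[].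
    apply: eq_bigr => x _; rewrite (bigD1 J) //= eqxx mulr1 big1 ?addr0 //.
    by move=> y /negPf->; rewrite mulr0 scale0r.
  transitivity (\sum_y \sum_x ((x == I)%:R * mxe (Rop R i) y J) *: f (x, y)).
    by rewrite exchange_big pair_big /=; apply: eq_bigr => -[].
  apply: eq_bigr => y _; rewrite (bigD1 I) //= eqxx mul1r big1 ?addr0 //.
  by move=> x /negPf->; rewrite mul0r scale0r.
have [|C [CA zC]] := @linear_system_param K _ _ _ A (fun j => zpow j.1 j.2).
  by case=> i [I J]; rewrite sumA /= zpow_Rop subrr.
(* Each row of [C] solves the system, that is, it is a matrix commuting with all R_i. *)
exists (fun a => multi_mx (fun I J => C a (I, J))); split=> [a i|I J].
  apply: mxeP => I J; rewrite !mxeM.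
  have := CA a (i, (I, J)); under eq_bigr => j _ do rewrite mulrC.
  rewrite (sumA K^o) /= => /eqP; rewrite subr_eq0 => /eqP E.
  apply: etrans (etrans E _); apply: eq_bigr => L _; first by rewrite mxe_multi.
  by rewrite mxe_multi [RHS]mulrC.
by rewrite [LHS](zC (I, J)); apply: eq_bigr => a _; rewrite mxe_multi.
Qed.

Lemma sum_cat (V : nmodType) m n (f : T (m + n) -> V) :
  \sum_L f L = \sum_(L : T m) \sum_(L' : T n) f (cat_tuple L L').
Proof.
rewrite pair_big (reindex (fun p : T m * T n => cat_tuple p.1 p.2)) //=.
exists (fun L => (sel (@lshift m n) L, sel (@rshift m n) L)) => [[L L'] _|L _] /=.
  by congr pair; apply: eq_from_tnth => a; rewrite tnth_sel ?tnth_lshift ?tnth_rshift.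
apply: eq_from_tnth => a; case: (split_ordP a) => b ->.
  by rewrite tnth_lshift tnth_sel.
by rewrite tnth_rshift tnth_sel.
Qed.

Lemma wpow_cat (A : algType K) (w : 'I_d -> 'I_d -> A) m n (I J : T m) (I' J' : T n) :
  wpow w (cat_tuple I I') (cat_tuple J J') = wpow w I J * wpow w I' J'.
Proof.
rewrite /wpow big_split_ord; congr (_ * _); apply: eq_bigr => a _.
  by rewrite !tnth_lshift.
by rewrite !tnth_rshift.
Qed.

(** At concatenated multi-indices the entries of the powers of D and Z split into products, those of
    Z in the right order, and the exponents m (r + 1) and n (r + 1) of [qh] add up. *)
Lemma PhiM m n (F : 'M[K]_#|{: T m}|) (G : 'M[K]_#|{: T n}|) :
  Phi F * Phi G = Phi (loc (@lshift m n) F *m loc (@rshift m n) G).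
Proof.
set X := loc _ F *m _.
have XE I J I' J' : mxe X (cat_tuple I I') (cat_tuple J J') = mxe F I J * mxe G I' J'.
  have lr a b : @lshift m n a != @rshift m n b by rewrite eq_lrshift.
  have sell (A : T m) (B : T n) : sel (@lshift m n) (cat_tuple A B) = A.
    by apply: eq_from_tnth => a; rewrite tnth_sel tnth_lshift.
  have selr (A : T m) (B : T n) : sel (@rshift m n) (cat_tuple A B) = B.
    by apply: eq_from_tnth => a; rewrite tnth_sel tnth_rshift.
  rewrite mxe_loc_disjoint // ?sell ?selr; last exact: lshift_inj.
  rewrite (_ : [forall _, _]) ?mul1r //; apply/forallP => a.
  case: (split_ordP a) => b ->; first by rewrite codom_f.
  by rewrite (codom_f (@rshift m n)) andbF.
have DXE I J I' J' : mxe (Dpow P (m + n) *m X) (cat_tuple I I') (cat_tuple J J') =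
    mxe (Dpow P m *m F) I J * mxe (Dpow P n *m G) I' J'.
  rewrite !mxeM sum_cat mulr_suml; apply: eq_bigr => L _.
  rewrite mulr_sumr; apply: eq_bigr => L' _.
  by rewrite XE !mxe_Dpow wpow_cat mulrACA.
rewrite !PhiE -scalerAl -scalerAr scalerA -exprD -mulnDl; congr (_ *: _).
rewrite sum_cat mulr_suml; apply: eq_bigr => I _.
rewrite mulr_sumr; apply: eq_bigr => I' _.
rewrite sum_cat mulr_suml; apply: eq_bigr => J _.
rewrite mulr_sumr; apply: eq_bigr => J' _.
by rewrite DXE wpow_cat -scalerAl -scalerAr scalerA.
Qed.

Let E_to_H_hyps :
  [/\ forall v : H_alg R, linear ( *%R^~ v), forall u : H_alg R, linear ( *%R u),
     forall s t : seq ('I_d * 'I_d),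
       \prod_(x <- s ++ t) Hz R x.1 x.2 =
       (\prod_(x <- s) Hz R x.1 x.2) * \prod_(x <- t) Hz R x.1 x.2
   & forall s, E_rel R s ->
       word_ext (fun w => \prod_(x <- w) Hz R x.1 x.2) s = 0].
Proof.
split=> [v a x y|u a x y|s t|_ [i j k l]].
- by rewrite mulrDl scalerAl.
- by rewrite mulrDr scalerAr.
- exact: big_cat.
set f := fun w => _; have fE a b : word_ext f (gen K a * gen K b) = Hz R a.1 a.2 * Hz R b.1 b.2.
  by have := word_ext_word f [:: a; b]; rewrite /f !big_cons !big_nil !mulr1.
have fsum (c : 'I_d -> 'I_d -> K) (a b : 'I_d -> 'I_d -> 'I_d * 'I_d) :
    word_ext f (\sum_m \sum_n c m n *: (gen K (a m n) * gen K (b m n))) =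
    \sum_m \sum_n c m n *: (Hz R (a m n).1 (a m n).2 * Hz R (b m n).1 (b m n).2).
  rewrite linear_sum; apply: eq_bigr => m _ /=; rewrite linear_sum.
  by apply: eq_bigr => n _; rewrite linearZ /= fE.
rewrite linearB /= (fsum (R i j) (fun m _ => (m, k)) (fun _ n => (n, l))).
rewrite (fsum (fun p s => R p s k l) (fun p _ => (i, p)) (fun _ s => (j, s))) /=.
by rewrite Hz_RZZ subrr.
Qed.

Lemma E_to_H_linear : linear (@E_to_H K d R).
Proof. by case: E_to_H_hyps => h1 h2 h3 h4; apply: (presented_ext_linear h1 h2 h3 h4). Qed.

Lemma E_to_H_word (w : seq ('I_d * 'I_d)) :
  E_to_H (\prod_(x <- w) pgen (E_rel R) x) = \prod_(x <- w) Hz R x.1 x.2.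
Proof. by case: E_to_H_hyps => h1 h2 h3 h4; apply: (presented_ext_word h1 h2 h3 h4). Qed.

Definition E_image (x : H_alg R) : Prop := exists y : E_alg R, E_to_H y = x.

Lemma E_image_lin a x y : E_image x -> E_image y -> E_image (a *: x + y).
Proof. by move=> [u <-] [v <-]; exists (a *: u + v); rewrite E_to_H_linear. Qed.

Lemma E_image1 : E_image 1.
Proof. by exists 1; have := E_to_H_word [::]; rewrite !big_nil. Qed.

Lemma E_image_sum (I : eqType) (s : seq I) (c : I -> K) F :
  (forall i, i \in s -> E_image (F i)) -> E_image (\sum_(i <- s) c i *: F i).
Proof.
have E0 : E_image 0.
  by have := E_image_lin (-1) E_image1 E_image1; rewrite scaleN1r addNr.
elim: s => [|i s IH] Fs; first by rewrite big_nil.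
rewrite big_cons; apply: E_image_lin; first exact: Fs (mem_head _ _).
by apply: IH => j js; apply: Fs; rewrite inE js orbT.
Qed.

Lemma E_image_Phi n (F : 'M[K]_#|{: T n}|) : E_image (Phi F).
Proof.
rewrite PhiE scaler_sumr; apply: E_image_sum => I _.
apply: E_image_sum => J _.
exists (\prod_(k < n) pgen (E_rel R) (tnth J k, tnth I k)).
have := E_to_H_word [seq (tnth J k, tnth I k) | k <- index_enum 'I_n].
by rewrite !big_map.
Qed.
End Commutation.

(** * The map from H_n to H_(n+1) and Hecke operators on some of the tensor factors *)

Section HeckeIncl.
Variables (K : fieldType) (q : K).

Lemma hecke_gen_braid n (i j : 'I_n.-1) : j = i.+1 :> nat ->
  hecke_gen q i * hecke_gen q j * hecke_gen q i =
  hecke_gen q j * hecke_gen q i * hecke_gen q j.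
Proof. by move=> /(hecke_braid q)/aq_rel; rewrite !aqM. Qed.

Lemma hecke_gen_comm n (i j : 'I_n.-1) : (i.+1 < j)%N ->
  hecke_gen q i * hecke_gen q j = hecke_gen q j * hecke_gen q i.
Proof. by move=> /(hecke_comm q)/aq_rel; rewrite !aqM. Qed.

Lemma hecke_gen_quad n (i : 'I_n.-1) :
  hecke_gen q i * hecke_gen q i = (q - 1) *: hecke_gen q i + q%:A.
Proof. by have /aq_rel := hecke_quad q i; rewrite expr2 aqM aqD !aqZ. Qed.

Local Notation f n := (fun w : seq 'I_n.-1 =>
  \prod_(i <- w) hecke_gen q (n := n.+1) (widen_ord (leq_pred n) i)).

Let incl_hyps n :
  [/\ forall v : hecke q n.+1, linear ( *%R^~ v), forall u : hecke q n.+1, linear ( *%R u),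
     forall s t : seq 'I_n.-1, f n (s ++ t) = f n s * f n t
   & forall s, hecke_rel q s -> word_ext (f n) s = 0].
Proof.
split=> [v a x y|u a x y|s t|_ [i j ij|i j ij|i]].
- by rewrite mulrDl scalerAl.
- by rewrite mulrDr scalerAr.
- exact: big_cat.
- have := word_ext_word (f n) [:: i; j; i]; have := word_ext_word (f n) [:: j; i; j].
  rewrite /= !big_cons !big_nil !mulr1 !mulrA => e1 e2.
  by rewrite linearB /= e1 e2 hecke_gen_braid ?subrr.
- have := word_ext_word (f n) [:: i; j]; have := word_ext_word (f n) [:: j; i].
  rewrite /= !big_cons !big_nil !mulr1 => e1 e2.
  by rewrite linearB /= e1 e2 hecke_gen_comm ?subrr.
have := word_ext_word (f n) [:: i; i]; have := word_ext_word (f n) [::].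
have := word_ext_word (f n) [:: i].
rewrite /= !big_cons !big_nil !mulr1 => e0 e1 e2.
by rewrite expr2 linearB linearD !linearZ /= e1 e2 e0 hecke_gen_quad subrr.
Qed.

Lemma hecke_incl_linear n : linear (@hecke_incl K q n).
Proof. by case: (incl_hyps n) => h1 h2 h3 h4; apply: (presented_ext_linear h1 h2 h3 h4). Qed.

Lemma hecke_inclM n (g h : hecke q n) :
  hecke_incl (g * h) = hecke_incl g * hecke_incl h.
Proof. by case: (incl_hyps n) => h1 h2 h3 h4; apply: (presented_extM h1 h2 h3 h4). Qed.

Lemma hecke_incl_word n (w : seq 'I_n.-1) :
  hecke_incl (\prod_(i <- w) hecke_gen q i) = f n w.
Proof. by case: (incl_hyps n) => h1 h2 h3 h4; apply: (presented_ext_word h1 h2 h3 h4). Qed.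

Lemma hecke_incl1 n : hecke_incl (1 : hecke q n) = 1.
Proof. by have := hecke_incl_word [::] (n := n); rewrite !big_nil. Qed.

Lemma hecke_incl_gen n (i : 'I_n.-1) :
  hecke_incl (hecke_gen q i) = hecke_gen q (n := n.+1) (widen_ord (leq_pred n) i).
Proof. by have := hecke_incl_word [:: i]; rewrite !big_seq1. Qed.

Variables (d : nat) (R P : tensor4 K d) (R_hecke : hecke_symmetry q R P).

(** Consequently an element killed by [rho] stays killed in H_(n+1). *)
Lemma rho_incl n (h : hecke q n) :
  rho R (hecke_incl h) = loc (widen_ord (leqnSn n)) (rho R h).
Proof.
have s_inj : injective (widen_ord (leqnSn n)) by move=> a b /(congr1 val)/= /val_inj.
elim/presented_ind: h => [|a u v IHu IHv|i u IHu].
- by rewrite hecke_incl1 !(rho1 R_hecke) loc1.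
- by rewrite hecke_incl_linear !(rho_linear R_hecke) loc_linear IHu IHv.
rewrite hecke_inclM hecke_incl_gen !(rhoM R_hecke) !(rho_gen R_hecke) locM // IHu.
by congr (_ *m _); apply/esym/loc_Rop => //; apply: val_inj.
Qed.

(** When [s] preserves adjacency, each generator moves to a generator. Taking the first m and the
    last m' factors brings two Hecke algebras into H_(m+m'). *)
Lemma loc_rho n k (s : 'I_k -> 'I_n) : injective s ->
    (forall i : 'I_k.-1, exists j : 'I_n.-1, s (site0 i) = site0 j /\ s (site1 i) = site1 j) ->
  forall h : hecke q k, exists h' : hecke q n, rho R h' = loc s (rho R h).
Proof.
move=> s_inj s_adj; elim/presented_ind => [|a u v [u' Eu] [v' Ev]|i u [u' Eu]].
- by exists 1; rewrite !(rho1 R_hecke) loc1.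
- by exists (a *: u' + v'); rewrite !(rho_linear R_hecke) loc_linear Eu Ev.
have [j [s0 s1]] := s_adj i; exists (hecke_gen q j * u').
by rewrite !(rhoM R_hecke) !(rho_gen R_hecke) locM // Eu (loc_Rop R s_inj s0 s1).
Qed.
End HeckeIncl.

(** * Partitions *)

Lemma size_le_sumn (l : seq nat) : 0%N \notin l -> (size l <= sumn l)%N.
Proof.
elim: l => //= x l IH; rewrite inE negb_or => /andP[x0 /IH].
by rewrite -add1n; apply: leq_add; rewrite lt0n eq_sym.
Qed.

Lemma sumn_le_size (l : seq nat) :
  0%N \notin l -> (sumn l <= size l)%N -> l = nseq (size l) 1%N.
Proof.
elim: l => //= x l IH; rewrite inE negb_or eq_sym -lt0n => /andP[x0 l0] sl.
have sl' := size_le_sumn l0; have x1 : x = 1%N.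
  by apply/eqP; rewrite eqn_leq x0 -(leq_add2r (sumn l)) (leq_trans sl) // add1n ltnS.
by rewrite {1}x1 {1}IH // -ltnS (leq_trans _ sl) // x1.
Qed.

Lemma mem_le_sumn (l : seq nat) x : x \in l -> (x <= sumn l)%N.
Proof.
elim: l => //= y l IH; rewrite inE => /orP[/eqP->|/IH xl]; first exact: leq_addr.
exact: leq_trans xl (leq_addl _ _).
Qed.

(** Length and entries of a partition of n are at most n, which makes the search finite; [undup]
    gives each partition a single term in sums. *)
Definition partns n : seq (seq nat) :=
  undup [seq l <- [seq map val (b : seq 'I_n.+1) | b : {bseq n of 'I_n.+1}] | is_partn n l].

Lemma mem_partns n l : (l \in partns n) = is_partn n l.
Proof.
rewrite mem_undup mem_filter; case lP: (is_partn n l) => //=.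
have /and3P[_ l0 /eqP ln] := lP.
have sz : (size (map (@inord n) l) <= n)%N by rewrite size_map -ln size_le_sumn.
apply/imageP; exists (Bseq sz) => //=; rewrite -map_comp map_id_in // => x xl /=.
by rewrite inordK // ltnS -ln mem_le_sumn.
Qed.

Lemma is_partn_nil n l : is_partn n l -> l = [::] -> n = 0%N.
Proof. by move=> /and3P[_ _ /eqP <-] ->. Qed.

Lemma partn_long n l : is_partn n l -> (n <= size l)%N -> l = nseq n 1%N.
Proof.
move=> /and3P[_ l0 /eqP ln] nl; rewrite -ln in nl.
have -> : n = size l by apply/eqP; rewrite -ln eqn_leq nl size_le_sumn.
exact: sumn_le_size.
Qed.

Lemma removable_size lam i : removable lam i -> (i < size lam)%N.
Proof.
by rewrite /removable; case: (ltnP i) => // /(nth_default 0%N) ->.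
Qed.

Lemma remove_partn n lam i :
  is_partn n.+1 lam -> removable lam i -> is_partn n (remove_node lam i).
Proof.
move=> /and3P[srt l0 /eqP ln] rm; have isz := removable_size rm.
have pi0 : (0 < nth 0 lam i)%N by apply: leq_trans rm.
apply/and3P; split; last 2 first.
- by rewrite mem_filter.
- have sf (s : seq nat) : sumn [seq p <- s | p != 0%N] = sumn s.
    by elim: s => //= x s IH; case: eqP => [->|_] /=; rewrite IH.
  rewrite /remove_node sf sumn_set_nth_ltn // ln.
  by case: (nth 0%N lam i) pi0 => // p _; rewrite /= addSn -addnS addnK.
apply: sorted_filter; first by move=> x y z /= yx xz; apply: leq_trans xz yx.
have nth_le j : (nth 0 lam j.+1 <= nth 0 lam j)%N.
  have [jsz|jsz] := ltnP j.+1 (size lam); last by rewrite nth_default.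
  by move/(sortedP 0%N): srt => /(_ j jsz).
apply/(sortedP 0%N) => j _; rewrite !nth_set_nth /= .
have [ji|ni] := eqVneq j.+1 i.
  by rewrite -ji ltn_eqF //; apply: leq_trans (leq_pred _) (nth_le j).
have [->|nj] := eqVneq j i; last exact: nth_le.
by rewrite -ltnS (ltn_predK pi0).
Qed.

Lemma size_remove_node lam i : 0%N \notin lam -> (i < size lam)%N ->
  size (remove_node lam i) = (size lam - (nth 0%N lam i == 1%N))%N.
Proof.
move=> l0 isz; rewrite size_filter count_set_nth_ltn //.
have -> : count (predC1 0%N) lam = size lam.
  by apply/eqP; rewrite -all_count; apply/allP => x xl; apply: contra l0 => /eqP <-.
have : nth 0%N lam i != 0%N by apply: contra l0 => /eqP <-; apply: mem_nth.
by case: (nth 0%N lam i) => [|[|p]] //= _; rewrite ?addn0 ?addn1 ?subn1 ?subn0.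
Qed.

(** If the first part is at least 2, a node of the last row of length at least 2 is removed and the
    number of parts is kept. Otherwise [lam] is a column, and n > r parts remain. *)
Lemma removable_long n r lam : is_partn n.+1 lam -> (r < size lam)%N -> (r < n)%N ->
  exists i, removable lam i /\ (r < size (remove_node lam i))%N.
Proof.
move=> lamP rl rn; have /and3P[srt l0 /eqP ln] := lamP.
have [p0|p0] := leqP 2 (nth 0%N lam 0).
  (* The first row shorter than 2, or the number of rows if there is none; row [j.-1] is the one to
     shorten. *)
  set j := find (fun p => p < 2)%N lam.
  have j0 : (0 < j)%N.
    by rewrite /j; case: (lam) p0 => //= p l p1; rewrite [(p < 2)%N]ltnNge p1.
  have pj1 : (2 <= nth 0%N lam j.-1)%N.
    have := @before_find _ 0%N (fun p => p < 2)%N lam j.-1.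
    by rewrite -/j prednK // => /(_ (leqnn _)) /= p2; rewrite leqNgt p2.
  have pj : (nth 0%N lam j < 2)%N.
    have [hs|] := boolP (has (fun p => p < 2)%N lam); first exact: (nth_find 0%N hs).
    by move/hasNfind; rewrite -/j => ->; rewrite nth_default.
  have rm : removable lam j.-1 by rewrite /removable prednK // (leq_trans pj pj1).
  exists j.-1; split=> //; rewrite size_remove_node ?removable_size //.
  by case: (nth 0%N lam j.-1) pj1 => [|[|p]] //= _; rewrite subn0.
have lam1 : lam = nseq (size lam) 1%N.
  apply/all_pred1P/allP => x /(nthP 0%N)[k ksz <-] /=; rewrite eqn_leq.
  have k0 : (nth 0%N lam k <= nth 0%N lam 0)%N.
    apply: (@sorted_leq_nth _ geq _ _ 0%N lam srt 0%N k) => //.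
    - by move=> x' y' z' /= yx xz; apply: leq_trans xz yx.
    - exact: leqnn.
    exact: leq_ltn_trans ksz.
  rewrite (leq_trans k0) // lt0n; apply: contra l0 => /eqP <-; exact: mem_nth.
have szn : size lam = n.+1 by rewrite -ln {2}lam1 sumn_nseq mul1n.
exists n; rewrite szn in lam1.
have rm : removable lam n by rewrite /removable lam1 !nth_nseq ltnn ltnSn.
split=> //; rewrite size_remove_node ?removable_size // szn.
by rewrite {1}lam1 nth_nseq ltnSn subn1.
Qed.

(** * Lengths of permutations *)

Lemma perm_len_sum n (w : 'S_n) :
  perm_len w = (\sum_(a < n) \sum_(b < n) ((a < b)%N && (w b < w a)%N))%N.
Proof.
rewrite /perm_len -sum1_card pair_big big_mkcond /=.
by apply: eq_bigr => -[a b] _; rewrite inE /=; case: ifP.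
Qed.

(** The last position takes the value j. Inversions among the other positions are those of [s], and
    the last position is inverted with the n - j larger values. *)
Lemma perm_len_lift n (j : 'I_n.+1) (s : 'S_n) :
  perm_len (lift_perm ord_max j s) = (perm_len s + (n - j))%N.
Proof.
have wid (a : 'I_n) : widen_ord (leqnSn n) a = lift ord_max a.
  by apply: val_inj; rewrite [RHS]lift_max.
rewrite !perm_len_sum big_ord_recr /= [X in (_ + X)%N]big1 ?addn0; last first.
  by move=> b _; rewrite ltnNge -ltnS ltn_ord.
under eq_bigr => a _ do rewrite big_ord_recr /= lift_perm_id wid lift_perm_lift ltn_ord.
rewrite big_split /=; congr (_ + _)%N.
  apply: eq_bigr => a _; apply: eq_bigr => b _; rewrite wid lift_perm_lift.
  by congr (nat_of_bool (_ && _)); rewrite /= /bump; lia.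
transitivity (\sum_(c < n) (j <= c))%N.
  rewrite [RHS](reindex_inj (@perm_inj _ s)); apply: eq_bigr => a _.
  by congr nat_of_bool; rewrite /= /bump; lia.
move: (nat_of_ord j) => k; elim: (n) => [|m IHm]; first by rewrite big_ord0.
by rewrite big_ord_recr /= IHm; lia.
Qed.

Lemma lift_perm_bij n :
  bijective (fun p : 'I_n.+1 * 'S_n => lift_perm ord_max p.1 p.2).
Proof.
apply: inj_card_bij => [[j s] [k t] /= e|]; last first.
  by rewrite card_prod card_ord !card_Sn factS.
have jk : j = k by rewrite -(lift_perm_id ord_max j s) e lift_perm_id.
rewrite jk in e *; congr pair; apply/permP => a; apply: (@lift_inj _ k).
by rewrite -!(lift_perm_lift ord_max) e.
Qed.

Local Notation s_ := (fun i => tperm (site0 i) (site1 i)).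

(** Induction on n - j: one further adjacent transposition moves the image of the last point from j
    + 1 down to j. *)
Lemma lift_perm_word n (j : 'I_n.+1) : exists2 t : seq 'I_n.+1.-1,
  size t = (n - j)%N & (\prod_(i <- t) s_ i)%g = lift_perm ord_max j 1%g.
Proof.
move Em: (n - j)%N => m; elim: m j Em => [|m IHm] j Em.
  have -> : j = ord_max by apply: val_inj => /=; have := ltn_ord j; lia.
  by exists [::]; rewrite ?big_nil ?lift_perm1.
have jn : (j < n)%N by lia.
have jn1 : (j.+1 < n.+1)%N by [].
have [|t szt tE] := IHm (Ordinal jn1); first by rewrite /=; lia.
pose i : 'I_n.+1.-1 := Ordinal jn.
exists (rcons t i); first by rewrite size_rcons szt.
have s0 : site0 i = j by apply: val_inj.
have s1 : site1 i = Ordinal jn1 by apply: val_inj.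
rewrite big_rcons tE s0 s1; apply/permP => x; rewrite permM.
case: (unliftP ord_max x) => [k|] ->; last by rewrite !lift_perm_id tpermR.
rewrite !lift_perm_lift !perm1; case: tpermP => [/(congr1 val)|/(congr1 val)|].
- move=> /= e; apply: val_inj; move: e; rewrite /= /bump; lia.
- move=> /= e; apply: val_inj; move: e; rewrite /= /bump; lia.
move=> /eqP + /eqP; rewrite -!val_eqE /= => n1 n2; apply: val_inj.
by move: n1 n2; rewrite /= /bump; lia.
Qed.

(** A permutation factors into one fixing the last point and one from [lift_perm_word]; the lengths
    add by [perm_len_lift]. Hence the default case of [reduced_word] never occurs. *)
Lemma reduced_word_exists n (w : 'S_n) : exists2 t : seq 'I_n.-1,
  size t = perm_len w & (\prod_(i <- t) s_ i)%g = w.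
Proof.
elim: n w => [|n IHn] w.
  exists [::]; last by rewrite big_nil; apply/permP => -[].
  by rewrite perm_len_sum big_ord0.
have [g _ gK] := lift_perm_bij n; rewrite -(gK w); case: (g w) => j s /=.
have [t szt tE] := IHn s; have [t' szt' tE'] := lift_perm_word j.
exists ([seq widen_ord (leq_pred n) i | i <- t] ++ t').
  by rewrite size_cat size_map szt szt' perm_len_lift.
rewrite big_cat /= tE' -[s]mulg1 -(lift_permM _ ord_max); congr (_ * _)%g.
rewrite -tE big_map; elim: (t) => [|i u IHu]; first by rewrite !big_nil lift_perm1.
rewrite !big_cons IHu -[RHS](lift_permM _ ord_max); congr (_ * _)%g.
apply/permP => x; case: (unliftP ord_max x) => [k|] ->; last first.
  rewrite lift_perm_id tpermD //; apply/eqP => /(congr1 val) /=.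
    by have := ltn_ord i; lia.
  by have := ltn_ord i; lia.
rewrite lift_perm_lift inj_tperm; last exact: lift_inj.
by congr (tperm _ _ _); apply: val_inj; rewrite /= /bump; have := ltn_ord i; lia.
Qed.

Lemma reduced_wordP n (w : 'S_n) : size (reduced_word w) = perm_len w.
Proof.
rewrite /reduced_word; case: pickP => [t _|no_t]; first by rewrite size_tuple.
have [t szt tE] := reduced_word_exists w.
have /eqP szt' := szt; have := no_t (Tuple szt').
by rewrite /= tE eqxx.
Qed.

(** By [perm_len_lift], passing from n to n + 1 multiplies the sum by 1 + x + ... + x^n. *)
Lemma poincare_neq0 (K : fieldType) (x : K) n :
  (forall m, (1 < m)%N -> x ^+ m != 1) -> \sum_(w : 'S_n) x ^+ perm_len w != 0.
Proof.
move=> xm; elim: n => [|n IHn].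
  rewrite (big_pred1 1%g) => [|w]; last by apply/esym/eqP/permP => -[].
  by rewrite perm_len_sum big_ord0 oner_neq0.
rewrite (reindex _ (onW_bij _ (lift_perm_bij n))) /=.
rewrite -(pair_bigA _ (fun j s => x ^+ perm_len (lift_perm ord_max j s))) /=.
under eq_bigr => j _.
  under eq_bigr => s _ do rewrite perm_len_lift exprD.
  rewrite -mulr_suml mulrC; over.
rewrite -mulr_suml mulf_neq0 //.
rewrite (reindex_inj rev_ord_inj) /=.
under eq_bigr => j _ do rewrite subSS (subKn (leq_ord j)).
(* The one-term sum is 1; a vanishing sum of n + 2 terms would give x^(n+2) = 1. *)
case: n {IHn} => [|n]; first by rewrite big_ord1 expr0 oner_neq0.
have := xm n.+2 isT; apply: contra => /eqP s0.
by rewrite -subr_eq0 subrX1 s0 mulr0.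
Qed.

(** * Characters of the Hecke algebra *)

Lemma irreducible_char_linear (K : fieldType) (A : algType K) (chi : A -> K) :
  irreducible_char chi -> forall a u v, chi (a *: u + v) = a * chi u + chi v.
Proof.
by move=> [m [f [[[lf _ _] _ _] chiE]]] a u v; rewrite !chiE lf mxtraceD mxtraceZ.
Qed.

Lemma irreducible_char_idempotent (K : fieldType) (A : algType K) (chi : A -> K) e :
  irreducible_char chi -> e * e = e -> exists m, chi e = m%:R.
Proof.
move=> [m [f [[[_ _ fM] _ _] chiE]]] ee; exists (\rank (f e)).
by rewrite chiE mxtrace_idempotent // -fM ee.
Qed.

(** In characteristic 0, the value 1 at the unit forces dimension 1, where the trace is
    multiplicative. *)
Lemma irreducible_char_mul (K : fieldType) (charK : [pchar K] =i pred0)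
    (A : algType K) (chi : A -> K) :
  irreducible_char chi -> chi 1 = 1 -> {morph chi : u v / u * v}.
Proof.
move=> [m [f [[[lf f1 fM] m0 _] chiE]]]; rewrite chiE f1 mxtrace1 => m1.
have {}m1 : m = 1%N.
  apply/eqP; rewrite eqn_leq m0 andbT -subn_eq0 -((pcharf0P _).1 charK).
  by rewrite natrB // m1 subrr.
move=> u v; rewrite !chiE fM; move: (f u) (f v); rewrite m1 => X Y.
by rewrite /mxtrace !big_ord1 mxE big_ord1.
Qed.

Section Labelling.
Variables (K : closedFieldType) (charK : [pchar K] =i pred0).
Variables (q : K) (q_neq0 : q != 0).
Hypothesis q_gen : forall m : nat, (1 < m)%N -> q ^+ m != 1.
Variable chi : forall n, seq nat -> hecke q n -> K.
Hypothesis chi_std : standard_labelling chi.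
Local Notation irr := (labelling_irr chi_std).

Lemma natf_eq0 m : (m%:R == 0 :> K) = (m == 0)%N.
Proof. exact: (pcharf0P K).1. Qed.

Lemma is_partn_ones n : is_partn n (nseq n 1%N).
Proof.
apply/and3P; split; last 2 first.
- by rewrite mem_nseq andbF.
- by rewrite sumn_nseq mul1n.
by case: n => //= n; elim: n => //= n ->.
Qed.

(** Only the last row of a column has a removable node, so the branching rule has a single term. *)
Lemma chi_ones_incl n (h : hecke q n) :
  chi (nseq n.+1 1%N) (hecke_incl h) = chi (nseq n 1%N) h.
Proof.
have lamP := is_partn_ones n.+1.
have rm : removable (nseq n.+1 1%N) n by rewrite /removable !nth_nseq ltnn ltnSn.
have nsz : (n < size (nseq n.+1 1%N))%N by rewrite size_nseq.
rewrite (labelling_branching chi_std) // (bigD1 (Ordinal nsz)) // big1; first rewrite [LHS]addr0.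
  congr (chi _ h); apply: partn_long; first exact: remove_partn.
  rewrite size_remove_node //; last by case/and3P: lamP.
  by rewrite nth_nseq ltnSn size_nseq subn1.
move=> i /andP[]; rewrite /removable !nth_nseq -val_eqE /= => + /eqP ni.
have i_n : (i < n.+1)%N by apply: leq_trans (ltn_ord i) _; rewrite size_nseq.
have i_n1 : (i.+1 < n.+1)%N by rewrite ltnS ltn_neqAle -ltnS i_n andbT; apply/eqP.
by rewrite i_n i_n1.
Qed.

Lemma chi_ones1 n : chi (nseq n 1%N) (1 : hecke q n) = 1.
Proof.
elim: n => [|n IHn]; last by rewrite -IHn -(hecke_incl1 q n) chi_ones_incl.
(* H_0 has no generators, so it consists of scalars. *)
have scal (h : hecke q 0) : exists c : K, h = c%:A.
  elim/presented_ind: h => [|a u v [c ->] [c' ->]|[]//].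
    by exists 1; rewrite scale1r.
  by exists (a * c + c'); rewrite scalerDl scalerA.
have [m [f [[[lf f1 _] m0 irr_f] ->]]] := irr (is_partn_ones 0).
have f0 : f 0 = 0 by have := lf (-1) 0 0; rewrite scaleN1r addNr scaleN1r addNr.
case: m f lf f1 m0 irr_f f0 => // m f lf f1 _ irr_f f0.
(* Scalars stabilize every line, so an irreducible representation is itself a line. *)
have [|U0|] := irr_f (delta_mx 0 0).
- move=> a; have [c ->] := scal a; have := lf c 1 0.
  rewrite !addr0 f0 addr0 f1 => ->.
  by rewrite linearZ /= trmx1 -scalemxAr mulmx1 scalemx_sub.
- by have /matrixP/(_ 0 0)/eqP := U0; rewrite !mxE !eqxx oner_eq0.
by rewrite /row_full mxrank_delta f1 mxtrace1 => /eqP<-.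
Qed.

(** All generators but the last come from H_(n-1). For the value c at the last one, the braid
    relation with its neighbour gives c = - c^2, and c = 0 is excluded because the quadratic
    relation would give q = 0. *)
Lemma chi_ones_gen n (i : 'I_n.-1) : chi (nseq n 1%N) (hecke_gen q i) = -1.
Proof.
have chiM m : {morph @chi m (nseq m 1%N) : u v / u * v}.
  by apply: irreducible_char_mul => //; [apply/irr/is_partn_ones | apply: chi_ones1].
elim: n i => [[]//|[_ []//|[|n] IHn]] i.
  by rewrite (ord1 i); apply: (labelling_col chi_std).
have [lt_in|] := ltnP i n.+1.
  have -> : i = widen_ord (leq_pred n.+2) (Ordinal lt_in) by apply: val_inj.
  by rewrite -hecke_incl_gen chi_ones_incl IHn.
move=> ge_in; have ei : i = n.+1 :> nat.
  by apply/eqP; rewrite eqn_leq ge_in andbT; apply: (ltn_ord i).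
have ltn1 : (n < n.+2)%N by [].
pose j : 'I_n.+3.-1 := Ordinal ltn1.
have cj : chi (nseq n.+3 1%N) (hecke_gen q j) = -1.
  have -> : j = widen_ord (leq_pred n.+2) (@ord_max n) by apply: val_inj.
  by rewrite -hecke_incl_gen chi_ones_incl IHn.
set c := chi _ (hecke_gen q i).
have c0 : c != 0.
  have := congr1 (@chi _ (nseq n.+3 1%N)) (hecke_gen_quad q i).
  rewrite chiM (irreducible_char_linear (irr (is_partn_ones _))) -/c => cq.
  apply: contraNneq q_neq0 => c0; move: cq; rewrite c0 !mulr0 add0r.
  have := irreducible_char_linear (irr (is_partn_ones n.+3)) q 1 0.
  have := irreducible_char_linear (irr (is_partn_ones n.+3)) (-1) 0 0.
  rewrite scaleN1r addNr mulN1r addNr => -> .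
  by rewrite !addr0 chi_ones1 mulr1 => -> /eqP; rewrite eq_sym.
have := congr1 (@chi _ (nseq n.+3 1%N)) (@hecke_gen_braid K q _ j i ei).
rewrite !chiM cj -/c mulN1r mulrN1 opprK => cc; apply: (mulfI c0).
by rewrite mulrN1 [in RHS]cc mulrN1 mulNr opprK.
Qed.

Lemma chi_ones_antisym n :
  chi (nseq n 1%N) (\sum_(w : 'S_n) (- q) ^- perm_len w *: hecke_T q w) != 0.
Proof.
have lin := irreducible_char_linear (irr (is_partn_ones n)).
have chiM : {morph @chi n (nseq n 1%N) : u v / u * v}.
  by apply: irreducible_char_mul => //; [apply/irr/is_partn_ones | apply: chi_ones1].
have chi0 : chi (nseq n 1%N) (0 : hecke q n) = 0.
  by have := lin (-1) 0 0; rewrite scaleN1r addNr mulN1r addNr.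
have chiT (w : 'S_n) : chi (nseq n 1%N) (hecke_T q w) = (-1) ^+ perm_len w.
  rewrite -reduced_wordP /hecke_T; elim: (reduced_word w) => [|i t IHt].
    by rewrite big_nil chi_ones1.
  by rewrite big_cons chiM IHt chi_ones_gen exprS.
rewrite (_ : chi _ _ = \sum_(w : 'S_n) q^-1 ^+ perm_len w).
  apply: poincare_neq0 => m m1; rewrite exprVn -invr1 (inj_eq invr_inj).
  exact: q_gen.
elim: (index_enum _) => [|w s IHs]; first by rewrite !big_nil chi0.
rewrite !big_cons lin IHs chiT; congr (_ + _).
by rewrite -exprVn -exprMn invrN mulNr mulrN1 opprK.
Qed.

(** * Traces expanded along the idempotents E_lambda, and vanishing beyond r rows *)

Variables (E : forall n, seq nat -> hecke q n).
Hypothesis E_idem : diagonal_idempotents chi E.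

Lemma E_idempotent n lam : is_partn n lam -> E n lam * E n lam = E n lam.
Proof. by move=> /E_idem[[]]. Qed.

Lemma chi_E n lam mu : is_partn n lam -> is_partn n mu ->
  chi mu (E n lam) = (lam == mu)%:R.
Proof. by move=> /E_idem[_]; apply. Qed.

Variables (d : nat) (R P : tensor4 K d) (R_hecke : hecke_symmetry q R P).
Local Notation rho := (rho (q := q) R).

(** The rank of the idempotent [rho (E n lam)] is its trace. The characters composing this trace
    vanish wherever [rho] does, which rules out [chi lam], and every other character is 0 at
    [E n lam]. *)
Lemma rho_E_eq0 n lam (a : hecke q n) : is_partn n lam ->
  rho a = 0 -> chi lam a != 0 -> rho (E n lam) = 0.
Proof.
move=> lamP ra0 chia; set e := E n lam.
have re : rho e *m rho e = rho e by rewrite -(rhoM R_hecke) E_idempotent.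
apply/eqP; rewrite -mxrank_eq0 -natf_eq0 -mxtrace_idempotent // -[rho e]mulmx1.
apply/eqP; pose Pr (phi : hecke q n -> K) := phi e = 0.
apply: (@commuting_trace_ind _ _ Pr _ (@Defs.rho K d q R n) 1%:M); rewrite /Pr //.
- by move=> u v -> ->; rewrite addr0.
- move=> c phi irr_phi van.
  have [mu muP phiE] := labelling_surj chi_std irr_phi.
  rewrite phiE chi_E //; case: eqP => [e_mu|_]; last by rewrite mulr0.
  by case/eqP: chia; rewrite e_mu -phiE van.
- exact: (rho_rep R_hecke).
- by move=> b; rewrite mulmx1 mul1mx.
Qed.

(** The expansion property is closed under sums and, by [chi_E], holds for multiples of irreducible
    characters; [commuting_trace_ind] does the rest. *)
Lemma mxtrace_rho_chi n (B : 'M[K]_#|{: n.-tuple 'I_d}|) :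
    (forall i, Rop R i *m B = B *m Rop R i) -> forall h : hecke q n,
  \tr (rho h *m B) = \sum_(lam <- partns n) chi lam h * \tr (rho (E n lam) *m B).
Proof.
move=> RB; pose Pr (phi : hecke q n -> K) :=
  forall h, phi h = \sum_(lam <- partns n) chi lam h * phi (E n lam).
apply: (@commuting_trace_ind _ _ Pr _ (@Defs.rho K d q R n) B).
- by move=> h; rewrite big1 // => lam _; rewrite mulr0.
- move=> u v Pu Pv h; rewrite Pu Pv -big_split; apply: eq_bigr => lam _ /=.
  by rewrite mulrDr.
- move=> c phi irr_phi _ h; have [mu muP phiE] := labelling_surj chi_std irr_phi.
  have mu_in : mu \in partns n by rewrite mem_partns.
  rewrite (bigD1_seq mu) ?undup_uniq //= [X in _ + X]big_seq_cond big1 ?addr0.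
    by rewrite !phiE chi_E // eqxx mulr1 mulrC.
  move=> lam /andP[lam_in /negPf lm]; rewrite mem_partns in lam_in.
  by rewrite phiE chi_E // lm !mulr0.
- exact: (rho_rep R_hecke).
- exact: (commute_rho R_hecke).
Qed.

Variables (r : nat) (R_even : even_of_rank q R r).

Lemma long_idempotent n : (r < n)%N -> exists e : hecke q n,
  [/\ e * e = e, rho e = 0 &
      forall lam, is_partn n lam -> (r < size lam)%N -> chi lam e != 0].
Proof.
elim: n => // n IHn; rewrite ltnS leq_eqVlt => /orP[/eqP <-|rn].
  have onesP := is_partn_ones r.+1; exists (E r.+1 (nseq r.+1 1%N)); split.
  - exact: E_idempotent.
  - apply: (rho_E_eq0 onesP _ (chi_ones_antisym r.+1)); rewrite -[RHS]R_even.2.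
    have rho0 : rho (0 : hecke q r.+1) = 0 by apply: is_rep0 (rho_rep R_hecke _).
    rewrite /antisymmetrizer; elim: (index_enum _) => [|w s IHs].
      by rewrite !big_nil.
    by rewrite !big_cons (rho_linear R_hecke) IHs.
  - move=> lam lamP rl; rewrite (partn_long lamP rl) chi_E // eqxx.
    exact: oner_neq0.
have [e [ee re0 chi_e]] := IHn rn; exists (hecke_incl e); split.
- by rewrite -hecke_inclM ee.
- by rewrite (rho_incl R_hecke) re0 loc0.
move=> lam lamP rl; have [i0 [rm0 r0]] := removable_long lamP rl rn.
rewrite (labelling_branching chi_std) //.
(* Every branching term is a natural number, and the one for [i0] is nonzero by induction; in
   characteristic 0 the sum cannot vanish. *)
have nat_term (i : 'I_(size lam)) : exists m, removable lam i ->
    chi (remove_node lam i) e = m%:R.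
  have [rm|_] := boolP (removable lam i); last by exists 0%N.
  have [m Em] := irreducible_char_idempotent (irr (remove_partn lamP rm)) ee.
  by exists m.
have [m Em] := fin_all_exists nat_term.
have i0sz := removable_size rm0.
rewrite (eq_bigr (fun i => (m i)%:R)); last by move=> i rm; apply: Em.
rewrite -natr_sum natf_eq0 (bigD1 (Ordinal i0sz)) //= addn_eq0 negb_and.
apply/orP; left; rewrite -natf_eq0 -Em //.
by apply: chi_e => //; apply: remove_partn.
Qed.

Lemma rho_E_long n lam : is_partn n lam -> (r < size lam)%N -> rho (E n lam) = 0.
Proof.
move=> lamP rl; have rn : (r < n)%N.
  by apply: leq_trans rl _; case/and3P: lamP => _ l0 /eqP<-; apply: size_le_sumn.
have [e [_ re chi_e]] := long_idempotent rn.
exact: rho_E_eq0 lamP re (chi_e _ lamP rl).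
Qed.
End Labelling.

(** * The subalgebra spanned by the S_lambda *)

Lemma S_E (K : fieldType) d (q : K) (R P : tensor4 K d) qh r
    (E : forall n, seq nat -> hecke q n) n lam :
  is_partn n lam -> (0 < n)%N -> S_ R P qh r E lam = Phi R P qh r (rho R (E n lam)).
Proof. by case: lam => [/is_partn_nil -> //|a l /and3P[_ _ /eqP <-]]. Qed.

Section LambdaClosure.
Variables (K : fieldType) (d : nat) (q : K) (R P : tensor4 K d) (qh : K) (r : nat).
Variable E : forall n, seq nat -> hecke q n.
Local Notation Lambda := (Lambda R P qh r E).

Lemma Lambda0 : Lambda 0.
Proof. by exists [::]; rewrite big_nil. Qed.

Lemma Lambda_lin a u v : Lambda u -> Lambda v -> Lambda (a *: u + v).
Proof.
move=> [s [sP ->]] [t [tP ->]]; exists ([seq (a * p.1, p.2) | p <- s] ++ t); split.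
  by move=> p; rewrite mem_cat => /orP[/mapP[p' /sP p'P ->]|/tP].
rewrite big_cat big_map /= scaler_sumr; congr (_ + _).
by apply: eq_bigr => p _; rewrite scalerA.
Qed.

Lemma Lambda_sum (I : eqType) (s : seq I) (c : I -> K) F :
  (forall i, i \in s -> Lambda (F i)) -> Lambda (\sum_(i <- s) c i *: F i).
Proof.
elim: s => [|i s IH] Fs; first by rewrite big_nil; apply: Lambda0.
rewrite big_cons; apply: Lambda_lin; first exact: Fs (mem_head _ _).
by apply: IH => j js; apply: Fs; rewrite inE js orbT.
Qed.

Lemma Lambda_S n lam : is_partn n lam -> (size lam <= r)%N -> Lambda (S_ R P qh r E lam).
Proof.
move=> lamP lr; exists [:: (1, lam)]; rewrite big_seq1 scale1r; split=> // p.
by rewrite inE => /eqP -> /=; case/and3P: (lamP) => _ _ /eqP sl; rewrite sl.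
Qed.
End LambdaClosure.

Theorem corollary5 (K : closedFieldType) (charK : [pchar K] =i pred0)
  (q qh : K) (q_neq0 : q != 0) (q_gen : forall m : nat, (1 < m)%N -> q ^+ m != 1)
  (qhE : qh ^+ 2 = q)
  (chi : forall n, seq nat -> hecke q n -> K)
  (chi_std : standard_labelling chi)
  (E : forall n, seq nat -> hecke q n)
  (E_idem : diagonal_idempotents chi E)
  (d r : nat) (R P : tensor4 K d)
  (R_hecke : hecke_symmetry q R P) (R_even : even_of_rank q R r)
  (n : nat) (n_gt0 : (0 < n)%N) :
  let tau (h : hecke q n) : H_alg R := Phi R P qh r (rho R h) in
  [/\ linear tau,
      forall h h' : hecke q n, tau (h * h') = tau (h' * h),
      is_subalgebra (Lambda R P qh r E),
      forall x, Lambda R P qh r E x -> exists y : E_alg R, E_to_H y = x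
    & forall h : hecke q n, Lambda R P qh r E (tau h)].
Proof.
(* Stated in every positive degree, because a product of two S_lambda lives in the sum of their
   degrees. *)
have tau_Lambda m (h : hecke q m) : (0 < m)%N -> Lambda R P qh r E (Phi R P qh r (rho R h)).
  move=> m0; have [B [RB zE]] := zpow_param R m.
  (* Substituting [zE] for the entries of Z leaves scalar traces as coefficients of fixed elements
     of H_R. *)
  have PhiB (F : 'M[K]_#|{: m.-tuple 'I_d}|) : Phi R P qh r F =
      \sum_a (qh ^+ (m * r.+1) * \tr (Dpow P m *m F *m B a)) *: wpow (Hz R) a.1 a.2.
    rewrite PhiE.
    transitivity (qh ^+ (m * r.+1) *:
        \sum_a \tr (Dpow P m *m F *m B a) *: wpow (Hz R) a.1 a.2).
      congr (_ *: _); under eq_bigr => I _ do under eq_bigr => J _ do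
        rewrite zE scaler_sumr.
      under eq_bigr => I _ do rewrite exchange_big /=.
      rewrite exchange_big; apply: eq_bigr => a _ /=.
      rewrite mxtrace_mxe scaler_suml; apply: eq_bigr => I _.
      rewrite mxeM scaler_suml; apply: eq_bigr => J _.
      by rewrite scalerA.
    by rewrite scaler_sumr; apply: eq_bigr => a _; rewrite scalerA.
  have trE a (g : hecke q m) :
      \tr (Dpow P m *m rho R g *m B a) = \tr (rho R g *m (B a *m Dpow P m)).
    by rewrite -mulmxA mxtrace_mulC mulmxA.
  have BD a i : Rop R i *m (B a *m Dpow P m) = B a *m Dpow P m *m Rop R i.
    rewrite -[Rop R i](rho_gen R_hecke) mulmxA (rho_gen R_hecke) RB -!mulmxA.
    by rewrite -[Rop R i](rho_gen R_hecke) (Dpow_rho R_hecke q_neq0).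
  (* [mxtrace_rho_chi] is applied to each matrix [B a *m Dpow P m], which commutes with the R_i by
     [BD]. *)
  have -> : Phi R P qh r (rho R h) = \sum_(lam <- partns m)
      chi m lam h *: Phi R P qh r (rho R (E m lam)).
    under [RHS]eq_bigr => lam _ do rewrite PhiB scaler_sumr.
    rewrite PhiB exchange_big; apply: eq_bigr => a _ /=.
    rewrite trE (mxtrace_rho_chi chi_std E_idem R_hecke (BD a)) mulr_sumr scaler_suml.
    by apply: eq_bigr => lam _; rewrite trE scalerA mulrCA.
  apply: Lambda_sum => lam; rewrite mem_partns => lamP.
  have [rl|lr] := ltnP r (size lam); last first.
    by rewrite -(S_E _ _ _ _ _ lamP m0); apply: Lambda_S lamP lr.
  rewrite (rho_E_long charK q_neq0 q_gen chi_std E_idem R_hecke R_even lamP rl).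
  rewrite PhiB big1 => [|a _]; first exact: Lambda0.
  by rewrite mulmx0 mul0mx mxtrace0 mulr0 scale0r.
split.
- by move=> a g h; rewrite (rho_linear R_hecke) Phi_linear.
- by move=> g h; apply: (Phi_trace R_hecke q_neq0).
- split; [|exact: Lambda_lin|].
    (* The unit is [S_] of the empty partition. *)
    exact: (@Lambda_S K d q R P qh r E 0 [::] isT isT).
  move=> u v [s [sP ->]] [t [tP ->]].
  rewrite mulr_suml; under eq_bigr => p _ do rewrite -scalerAl.
  apply: Lambda_sum => p /sP[pP pr]; rewrite mulr_sumr.
  under eq_bigr => p' _ do rewrite -scalerAr.
  apply: Lambda_sum => p' /tP[p'P p'r].
  (* The empty partition is treated apart, as its [S_] is 1 by convention. *)
  case El: p.2 => [|a l]; first by rewrite mul1r; apply: Lambda_S p'P p'r.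
  case El': p'.2 => [|a' l']; first by rewrite mulr1 -El; apply: Lambda_S pP pr.
  (* Both idempotents, placed on the first m and on the last m' factors, are images of elements of
     H_(m+m'), so [tau_Lambda] applies to their product. *)
  rewrite /S_ PhiM.
  set m := sumn (a :: l); set m' := sumn (a' :: l').
  have m_gt0 : (0 < m)%N.
    by move: pP; rewrite El => /and3P[_ l0 _]; apply: leq_trans (size_le_sumn l0).
  have [h1 <-] : exists h1 : hecke q (m + m'),
      rho R h1 = loc (@lshift m m') (rho R (E m (a :: l))).
    apply: (loc_rho R_hecke (@lshift_inj m m')) => i.
    (* The generator [i] of the second algebra moves to index m + i, and m + i + 1 is still a site
       since i + 1 < m'. *)
    have im : (i < (m + m').-1)%N by have := ltn_ord i; lia.
    by exists (Ordinal im); split; apply: val_inj.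
  have [h2 <-] : exists h2 : hecke q (m + m'),
      rho R h2 = loc (@rshift m m') (rho R (E m' (a' :: l'))).
    apply: (loc_rho R_hecke (@rshift_inj m m')) => i.
    have im : (m + i < (m + m').-1)%N by have := ltn_ord i; lia.
    by exists (Ordinal im); split; apply: val_inj => //=; rewrite addnS.
  by rewrite -(rhoM R_hecke); apply: tau_Lambda; rewrite addn_gt0 m_gt0.
- move=> x [s [_ ->]]; apply: E_image_sum => p _.
  by case: p.2 => [|a l]; [exact: E_image1 | exact: E_image_Phi].
by move=> h; apply: tau_Lambda.
Qed.
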